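(* Fix $\varepsilon>0$. Let $\Gamma\in C_b^1(\mathbb{R})$ be $2\pi$-periodic, let $H\in C_b^1(\mathbb{R}^2)$ be $2\pi$-periodic in each argument, let $\omega\in L^\infty([0,1])$ and $(\theta_0,a_0)\in X$. Suppose that for each $N$ there are step fields $\theta_0^N,\omega^N$ (constant on each cell $I_i^N$) and $a_0^N$ (constant on each $I_i^N\times I_j^N$) with $$\|\theta_0^N-\theta_0\|_\infty+\|a_0^N-a_0\|_\infty+\|\omega^N-\omega\|_\infty\to0\quad(N\to\infty).$$ For each $N$, let $(\theta^N,a^N)$ be the step-field solution induced by the finite network, with initial data the step coefficients of $(\theta_0^N,a_0^N)$ and frequencies $\omega_i^N$ the step coefficients of $\omega^N$. Let $(\theta,a)$ be the strong solution of the continuum system with frequency $\omega$ and initial data $(\theta_0,a_0)$. Then for every fixed $T>0$, $$\sup_{t\in[0,T]}\bigl(\|\theta^N(t)-\theta(t)\|_\infty+\|a^N(t)-a(t)\|_\infty\bigr)\to0\quad(N\to\infty).$$ More precisely, define $$R_{a,*}:=\max\Bigl\{M_H,\|a_0\|_\infty,\sup_{N}\|a_0^N\|_\infty\Bigr\},\qquad \Lambda_*:=2R_{a,*}L_\Gamma+2M_\Gamma M_{DH},$$ $$E_\theta^N:=\|\theta_0^N-\theta_0\|_\infty,\quad E_a^N:=\|a_0^N-a_0\|_\infty,\quad E_\omega^N:=\|\omega^N-\omega\|_\infty .$$ Then for all $N$ and all $t\in[0,T]$, $$\|\theta^N(t)-\theta(t)\|_\infty\le e^{\Lambda_* t}\bigl(E_\theta^N+tE_\omega^N+\varepsilon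 M_\Gamma E_a^N\bigr),$$ $$\|a^N(t)-a(t)\|_\infty\le e^{-t/\varepsilon}E_a^N+2M_{DH}e^{\Lambda_* t}\bigl(E_\theta^N+tE_\omega^N+\varepsilon M_\Gamma E_a^N\bigr).$$ Consequently $$\sup_{t\in[0,T]}\|(\theta^N,a^N)(t)-(\theta,a)(t)\|_X\le E_a^N+(1+2M_{DH})e^{\Lambda_*T}\bigl(E_\theta^N+TE_\omega^N+\varepsilon M_\Gamma E_a^N\bigr).$$ In particular, for every $\varepsilon_0>0$, the constant $C_{T,\varepsilon_0}:=1+(1+2M_{DH})e^{\Lambda_*T}\max\{1,T,\varepsilon_0M_\Gamma\}$ gives the uniform bound $$\sup_{t\in[0,T]}\|(\theta^N,a^N)(t)-(\theta,a)(t)\|_X\le C_{T,\varepsilon_0}\bigl(E_\theta^N+E_a^N+E_\omega^N\bigr)$$ for every $\varepsilon\in(0,\varepsilon_0]$.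
   Context: $X_\theta=L^\infty([0,1])$, $X_a=L^\infty([0,1]^2)$ (real-valued), $X=X_\theta\times X_a$ with norm $\|(\theta,a)\|_X=\|\theta\|_\infty+\|a\|_\infty$ (essential supremum norms). $C_b^k$ denotes $C^k$ functions bounded together with all partial derivatives up to order $k$. Constants: $M_\Gamma=\|\Gamma\|_\infty$, $L_\Gamma=\|\Gamma'\|_\infty$, $M_H=\|H\|_\infty$, $M_{DH}=\max_{r=1,2}\|\partial_rH\|_\infty$. Cells: $I_1^N=[0,1/N]$, $I_i^N=((i-1)/N,i/N]$ for $2\le i\le N$. Finite network (for $1\le i,j\le N$, real-valued lifts of phases): $$\dot\theta_i^N=\omega_i^N+\frac1N\sum_{j=1}^N a_{ij}^N\Gamma(\theta_j^N-\theta_i^N),\qquad \varepsilon\dot a_{ij}^N=-a_{ij}^N+H(\theta_i^N,\theta_j^N).$$ The induced step-field solution is $\theta^N(t,x)=\theta_i^N(t)$ for $x\in I_i^N$ and $a^N(t,x,y)=a_{ij}^N(t)$ for $(x,y)\in I_i^N\times I_j^N$. Continuum system: $\partial_t\theta(x)=\omega(x)+\int_0^1a(x,y)\Gamma(\theta(y)-\theta(x))\,dy$, $\ \varepsilon\partial_ta(x,y)=-a(x,y)+H(\theta(x),\theta(y))$, $(\theta,a)|_{t=0}=(\theta_0,a_0)$. A strong solution on $[0,T]$ is $(\theta,a)\in W^{1,\infty}([0,T];X)$ satisfying the initial condition and the equations for a.e. $t$; under the stated hypotheses it exists uniquely for all times. *)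

(* Defs.v *)
From HB Require Import structures.
From mathcomp Require Import all_boot all_order all_algebra.
From mathcomp Require Import all_classical all_reals all_analysis.

Set Implicit Arguments.
Unset Strict Implicit.
Unset Printing Implicit Defensive.

Import Order.TTheory GRing.Theory Num.Theory.
Import numFieldNormedType.Exports.

Local Open Scope classical_set_scope.
Local Open Scope ring_scope.

Section smooth_bounded.
Context {R : realType}.

Definition supnorm {T : Type} (f : T -> R) : R := sup (range (fun x => `|f x|)).

Definition is_Cb1 (f : R -> R) : Prop :=
  [/\ forall x, derivable f x 1, continuous (derive1 f), bounded_fun f
    & bounded_fun (derive1 f)].

Definition partial1 (H : R * R -> R) : R * R -> R := fun p => 'D_(1, 0) H p.
Definition partial2 (H : R * R -> R) : R * R -> R := fun p => 'D_(0, 1) H p.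

Definition is_Cb1_2 (H : R * R -> R) : Prop :=
  [/\ (forall p, derivable H p (1, 0) /\ derivable H p (0, 1)),
      [/\ continuous H, continuous (partial1 H) & continuous (partial2 H)]
    & [/\ bounded_fun H, bounded_fun (partial1 H) & bounded_fun (partial2 H)]].

End smooth_bounded.

(* L^oo([0,1]) and L^oo([0,1]^2) are handled through representatives: Borel
   functions on the line (plane), for the restriction [mu1] of the Lebesgue
   measure to [0,1] ([mu2] to [0,1]^2). Two representatives give the same
   element of the space when the norm of their difference is 0. *)
Section spaces.
Context {R : realType}.

Lemma lebesgue01_lty : (@lebesgue_measure R `[0%R, 1%R] < +oo)%E.
Proof. by rewrite lebesgue_measure_itv/= lte_fin ltr01 -EFinB ltry. Qed.

Definition mu1 : set (measurableTypeR R) -> \bar R :=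
  @mfrestr _ (measurableTypeR R) R `[0%R : R, 1%R]%classic lebesgue_measure
    (measurable_itv `[0%R : R, 1%R]) lebesgue01_lty.
HB.instance Definition _ := FiniteMeasure.on mu1.

Definition mu2 : set (measurableTypeR R * measurableTypeR R) -> \bar R :=
  (mu1 \x mu1)%E.
HB.instance Definition _ := Measure.on mu2.

Definition norm1 (f : R -> R) : \bar R := ('N[mu1]_+oo [EFin \o f])%E.
Definition norm2 (f : R * R -> R) : \bar R := ('N[mu2]_+oo [EFin \o f])%E.

Definition Xvec : lmodType R := ((R -> R) * (R * R -> R))%type.

Definition inX (u : Xvec) : Prop :=
  u.1 \in Lfun mu1 +oo /\ u.2 \in Lfun mu2 +oo.

Definition normX (u : Xvec) : \bar R := (norm1 u.1 + norm2 u.2)%E.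

End spaces.

(* Bochner integration and the Sobolev space W^{1,oo}([0,T];X), for the
   subspace X of a vector space V on which the (semi)norm nX is finite. *)
Section vector_valued.
Context {R : realType} (V : lmodType R) (X : set V) (nX : V -> \bar R) (T : R).
Notation leb := (@lebesgue_measure R).
Notation I := (`[0, T]%classic : set R).

(* [:: (A_1, v_1); ...; (A_n, v_n)] stands for the simple function
   \sum_i 1_(A_i) v_i; the A_i need not be disjoint. *)
Definition simple_ok (s : seq (set R * V)) : Prop :=
  forall p, p \in s -> measurable p.1 /\ X p.2.

Definition simple_val (s : seq (set R * V)) (t : R) : V :=
  \sum_(p <- s) (\1_(p.1) t : R) *: p.2.

Definition simple_int (s : seq (set R * V)) : V :=
  \sum_(p <- s) fine (leb (p.1 `&` I)) *: p.2.

Definition simple_approx (f : R -> V) (s : nat -> seq (set R * V)) : Prop :=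
  (forall n, simple_ok (s n)) /\
  {ae leb, forall t, I t -> nX (f t - simple_val (s n) t) @[n --> \oo] --> 0%E}.

Definition strongly_measurable (f : R -> V) : Prop :=
  exists s, simple_approx f s.

Definition is_bochner_int (f : R -> V) (v : V) : Prop :=
  X v /\ exists s : nat -> seq (set R * V),
  [/\ simple_approx f s,
      (\int[leb]_(t in I) nX (f t - simple_val (s n) t))%E @[n --> \oo] --> 0%E
    & nX (simple_int (s n) - v) @[n --> \oo] --> 0%E].

Definition in_Linfty (f : R -> V) : Prop :=
  strongly_measurable f /\
  exists M : R, {ae leb, forall t, I t -> (nX (f t) <= M%:E)%E}.

Definition test_function (phi : R -> R) : Prop :=
  [/\ forall t, derivable phi t 1, continuous (derive1 phi)
    & exists a b, [/\ 0 < a, b < T & forall t, ~ `[a, b]%classic t -> phi t = 0]].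

Definition weak_derivative (u g : R -> V) : Prop :=
  forall phi, test_function phi ->
  exists2 v, is_bochner_int (fun t => derive1 phi t *: u t) v
           & is_bochner_int (fun t => phi t *: g t) (- v).

Definition continuous_on_I (u : R -> V) : Prop :=
  forall t, I t ->
    X (u t) /\ nX (u s - u t) @[s --> within I (nbhs t)] --> 0%E.

(* [u] is the continuous representative of an element of W^{1,oo}([0,T];X)
   whose weak derivative is represented by [g]. Test functions are C^1 with
   compact support in ]0,T[. *)
Definition is_W1oo (u g : R -> V) : Prop :=
  [/\ continuous_on_I u, in_Linfty u, in_Linfty g & weak_derivative u g].

End vector_valued.

Section systems.
Context {R : realType} (eps : R) (Gam : R -> R) (H : R * R -> R).

Definition continuum_rhs (om : R -> R) (u : @Xvec R) : @Xvec R :=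
  (fun x => om x + \int[mu1]_y (u.2 (x, y) * Gam (u.1 y - u.1 x)),
   fun p => eps^-1 * (- u.2 p + H (u.1 p.1, u.1 p.2))).

Definition strong_solution (om : R -> R) (u0 : @Xvec R) (T : R)
    (u : R -> @Xvec R) : Prop :=
  normX (u 0 - u0) = 0%E /\
  exists2 g, is_W1oo inX normX T u g &
    {ae (@lebesgue_measure R), forall t, `[0, T]%classic t ->
      normX (g t - continuum_rhs om (u t)) = 0%E}.

(* Indices run over 0, ..., N - 1. The equations are imposed for t > 0 together
   with continuity on [0, +oo[, i.e. (the vector field being continuous)
   the functions are C^1 on [0, +oo[ with a one-sided derivative at 0. *)
Definition network_solution (N : nat) (om th0 : 'I_N -> R)
    (a0 : 'I_N -> 'I_N -> R) (th : 'I_N -> R -> R) (a : 'I_N -> 'I_N -> R -> R)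
    : Prop :=
  [/\ (forall i, th i 0 = th0 i) /\ (forall i j, a i j 0 = a0 i j),
      (forall i, {within `[0, +oo[, continuous (th i)}) /\
      (forall i j, {within `[0, +oo[, continuous (a i j)}),
      (forall i t, 0 < t -> derivable (th i) t 1 /\
         derive1 (th i) t =
         om i + N%:R^-1 * \sum_(j < N) a i j t * Gam (th j t - th i t))
    & (forall i j t, 0 < t -> derivable (a i j) t 1 /\
         eps * derive1 (a i j) t = - a i j t + H (th i t, th j t))].

End systems.

Section step_fields.
Context {R : realType}.

(* With 0-based indices, cell N 0 = [0, 1/N] and cell N i = ]i/N, (i+1)/N]. *)
Definition cell (N : nat) (i : 'I_N) : set R :=
  if i == 0%N :> nat then `[0, N%:R^-1]%classic
  else `]i%:R / N%:R, i.+1%:R / N%:R]%classic.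

Definition step1 (N : nat) (c : 'I_N -> R) : R -> R :=
  fun x => \sum_(i < N) c i * \1_(cell i) x.

Definition step2 (N : nat) (c : 'I_N -> 'I_N -> R) : R * R -> R :=
  fun p => \sum_(i < N) \sum_(j < N) c i j * (\1_(cell i) p.1 * \1_(cell j) p.2).

Definition stepX (N : nat) (th : 'I_N -> R -> R) (a : 'I_N -> 'I_N -> R -> R)
    (t : R) : @Xvec R :=
  (step1 (fun i => th i t), step2 (fun i j => a i j t)).

End step_fields.

Section constants.
Context {R : realType} (Gam : R -> R) (H : R * R -> R).

Definition M_DH : R := Num.max (supnorm (partial1 H)) (supnorm (partial2 H)).

Definition R_star (a0 : R * R -> R) (a0N : forall N, 'I_N -> 'I_N -> R) : R :=
  Num.max (supnorm H) (Num.max (fine (norm2 a0))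
    (sup [set fine (norm2 (step2 (a0N N))) | N in [set N | (0 < N)%N]])).

Definition Lambda_star (Ra : R) : R :=
  2 * Ra * supnorm (derive1 Gam) + 2 * supnorm Gam * M_DH.

End constants.

(* Main.v *)
Require Import Defs.
From HB Require Import structures.
From mathcomp Require Import all_boot all_order all_algebra.
From mathcomp Require Import all_classical all_reals all_analysis.
From mathcomp Require Import measurable_realfun ess_sup_inf.
From mathcomp Require Import ring lra.

(** A step field built from a solution of the finite network solves the continuum
    system exactly, with the step frequency in place of [om]: on a pair of
    cells the interaction integral is the network sum, because every cell
    has mass 1/N ([rhs_step], [network_weak_path]). So the theorem is a stability
    estimate for two solutions of one evolution equation in [X], with different
    frequencies and initial data ([stability]).

    Let [p t] and [q t] be the norms of the phase and weight components of the
    difference. Formally, with [M] the maximum of the first derivatives of [H],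
      p' <= E_om + M_Gam q + 2 Ra L_Gam p   and   eps q' <= - q + 2 M p,
    where [Ra] bounds the weights of the network: each weight relaxes towards a
    value of [H] and so never exceeds the larger of [M_H] and its initial value
    ([network_weight_le]). In the combination p + eps M_Gam q the two terms
    in [q] cancel, which leaves s' <= E_om + Lam s with the growth
    rate [Lam] of the statement, uniformly in [eps]. Gronwall's lemma gives the bound on [p], and
    substituting it in the second inequality gives the bound on [q]
    ([comparison_bound]).

    The norms are essential suprema and a strong solution solves its equation
    only in the sense of Bochner integrals against test functions, so neither
    [p] nor [q] can be differentiated. Everything is therefore tested against
    the means over measurable sets. On the one hand a bound on all means is a
    bound on the essential supremum ([ae_le_normr_Rintegral]). On the other
    hand the Bochner integral commutes with bounded functionals
    ([bochner_functional]), so each mean [L (u t)] has the weak derivative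
    [L (rhs (u t))]; this is continuous in [t], and du Bois-Reymond's lemma makes
    [L (u t)] classically differentiable ([W1oo_is_derive]). The two
    differential inequalities hold for every mean, uniformly in the set, and
    this is enough to compare [p] and [q] with supersolutions
    ([family_subsolution]). *)

Set Implicit Arguments.
Unset Strict Implicit.
Unset Printing Implicit Defensive.

Import Order.TTheory GRing.Theory Num.Theory.
Import numFieldNormedType.Exports.

Local Open Scope classical_set_scope.
Local Open Scope ring_scope.

(** * Essential suprema and averages *)

Section ess_norm.
Context {d} {S : measurableType d} {R : realType}.
Variable mu : {measure set S -> \bar R}.
Hypotheses (mu_gt0 : (0 < mu setT)%E) (mu_fin : (mu setT < +oo)%E).
Implicit Types (f : S -> R) (C : R).

Lemma Lnorm_ooE f : ('N[mu]_+oo [EFin \o f])%E = ess_sup mu (abse \o (EFin \o f)).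
Proof. by rewrite unlock mu_gt0. Qed.

Lemma Lnorm_oo_leP f C : ('N[mu]_+oo [EFin \o f] <= C%:E)%E <->
  \forall x \ae mu, `|f x| <= C.
Proof.
rewrite Lnorm_ooE; split.
- by move=> /ess_supP; apply: filterS => x /=; rewrite lee_fin.
- by move=> h; apply/ess_supP; apply: filterS h => x /=; rewrite lee_fin.
Qed.

Lemma Lnorm_oo_ae f : ('N[mu]_+oo [EFin \o f] < +oo)%E ->
  \forall x \ae mu, `|f x| <= fine ('N[mu]_+oo [EFin \o f])%E.
Proof. by move=> h; apply: (Lnorm_oo_leP _ _).1; rewrite fineK// ge0_fin_numE ?Lnorm_ge0. Qed.

Lemma Lfun_ooP f : f \in Lfun mu +oo <->
  measurable_fun setT f /\ ('N[mu]_+oo [EFin \o f] < +oo)%E.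
Proof.
split.
- move=> /[dup] /sub_Lfun_mfun; rewrite inE => /= mf /sub_Lfun_finLfun.
  by rewrite inE.
- by move=> [mf ff]; apply/andP; split; rewrite inE.
Qed.

Lemma Lfun_oo_bounded f C : measurable_fun setT f ->
  (\forall x \ae mu, `|f x| <= C) -> f \in Lfun mu +oo.
Proof.
by move=> mf /(Lnorm_oo_leP _ _).2 h; apply/Lfun_ooP; split=> //; rewrite (le_lt_trans h)// ltry.
Qed.

Lemma Lfun_oo_integrable f A : measurable A -> f \in Lfun mu +oo ->
  mu.-integrable A (EFin \o f).
Proof.
move=> mA /Lfun_ooP[mf ff].
apply: (@integrableS _ _ _ mu setT) => //.
apply/integrableP; split; first exact/measurable_EFinP.
have h : (\int[mu]_x `|(EFin \o f) x| <=
          \int[mu]_x (cst (fine ('N[mu]_+oo [EFin \o f]))%:E) x)%E.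
  apply: ae_ge0_le_integral => //.
  - by apply: measurableT_comp => //; exact/measurable_EFinP.
  - by move=> x _; rewrite lee_fin fine_ge0 ?Lnorm_ge0.
  - by have := Lnorm_oo_ae ff; apply: filterS => x h _ /=; rewrite lee_fin.
apply: (le_lt_trans h); rewrite integral_cst//.
by rewrite lte_mul_pinfty// lee_fin fine_ge0 ?Lnorm_ge0.
Qed.

Lemma le_normr_Rintegral_ae f A C : measurable A ->
  mu.-integrable A (EFin \o f) ->
  (\forall x \ae mu, `|f x| <= C) ->
  `|\int[mu]_(x in A) f x| <= C * fine (mu A).
Proof.
move=> mA fi fC.
have muA : (mu A < +oo)%E.
  by rewrite (le_lt_trans _ mu_fin)// le_measure// inE.
have muAf : mu A \is a fin_num by rewrite ge0_fin_numE.
have C0 : 0 <= C.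
  have ae_proper := ae_properfilter_algebraOfSetsType mu_gt0.
  by have /filter_ex[x] := fC; apply: le_trans.
apply: (le_trans (le_normr_Rintegral mA fi)).
rewrite -lee_fin /Rintegral EFinM fineK//; last first.
  by rewrite ge0_fin_numE ?integral_ge0//; case/integrableP : fi.
rewrite fineK// -integral_cst//.
apply: ae_ge0_le_integral => //.
- apply: measurableT_comp => //; apply: measurableT_comp => //.
  by case/integrableP : fi => /measurable_EFinP.
- by apply: filterS fC => x h _; rewrite lee_fin.
Qed.

Let ae_le_of_Rintegral f C : mu.-integrable setT (EFin \o f) ->
  (forall A, measurable A -> \int[mu]_(x in A) f x <= C * fine (mu A)) ->
  \forall x \ae mu, f x <= C.
Proof.
move=> fi fC.
have mf : measurable_fun setT f by case/integrableP : fi => /measurable_EFinP.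
pose A := [set x | C < f x].
have mA : measurable A.
  by rewrite -[A]setTI; exact: (measurable_fun_ltr (measurable_cst C) mf).
have muA : (mu A < +oo)%E.
  by rewrite (le_lt_trans _ mu_fin)// le_measure// inE.
have muAf : mu A \is a fin_num by rewrite ge0_fin_numE.
have fiA : mu.-integrable A (EFin \o f) by exact: integrableS fi.
have ci : mu.-integrable A (EFin \o cst C).
  apply/integrableP; split; first exact/measurable_EFinP.
  under eq_integral do rewrite /=.
  by rewrite integral_cst//= lte_mul_pinfty.
have gi : mu.-integrable A (EFin \o (fun x => f x - C)).
  by rewrite (_ : _ \o _ = (EFin \o f) \- (EFin \o cst C))%E//; exact: integrableB.
have int0 : (\int[mu]_(x in A) `|(f x - C)%:E| = 0)%E.
  apply/eqP; rewrite eq_le integral_ge0// andbT.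
  have -> : (\int[mu]_(x in A) `|(f x - C)%:E| = (\int[mu]_(x in A) (f x - C))%:E)%E.
    rewrite /Rintegral fineK; last exact: integrable_fin_num.
    apply: eq_integral => x; rewrite inE => Ax.
    by rewrite gee0_abs// lee_fin subr_ge0 ltW.
  by rewrite RintegralB// Rintegral_cst// lee_fin subr_le0 fC.
have mg : measurable_fun A (EFin \o (fun x => f x - C)) by case/integrableP : gi.
have /(ae_eq_integral_abs mu mA mg) := int0.
apply: filterS => x h; rewrite leNgt; apply/negP => Cf.
have [] := h Cf => /eqP.
by rewrite subr_eq0 gt_eqF.
Qed.

(** Means over measurable sets form a norming family for the essential
    supremum: testing the hypothesis on the set where the bound fails shows that
    this set is negligible. *)
Lemma ae_le_normr_Rintegral f C : mu.-integrable setT (EFin \o f) ->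
  (forall A, measurable A -> `|\int[mu]_(x in A) f x| <= C * fine (mu A)) ->
  \forall x \ae mu, `|f x| <= C.
Proof.
move=> fi fC.
have h1 : \forall x \ae mu, f x <= C.
  by apply: ae_le_of_Rintegral => // A mA; rewrite (le_trans (ler_norm _)) ?fC.
have h2 : \forall x \ae mu, - f x <= C.
  apply: (@ae_le_of_Rintegral (fun x => - f x)).
    by rewrite (_ : _ \o _ = \- (EFin \o f))%E//; exact: integrableN.
  move=> A mA; rewrite (le_trans _ (fC _ mA))//.
  have -> : \int[mu]_(x in A) (- f x) = - \int[mu]_(x in A) f x.
    under eq_Rintegral do rewrite -mulN1r.
    by rewrite RintegralZl ?mulN1r//; exact: integrableS fi.
  by rewrite -normrN ler_norm.
apply: filterS2 h1 h2 => x h1 h2.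
by rewrite ler_norml lerNl h1 h2.
Qed.

End ess_norm.

(** * Scalar calculus and du Bois-Reymond's lemma *)

Section scalar_calculus.
Context {R : realType}.
Notation leb := (@lebesgue_measure R).
Implicit Types (f F W h w : R -> R) (a b x T : R).

Lemma continuous_integrable_itv f a b : continuous f ->
  leb.-integrable `[a, b] (EFin \o f).
Proof.
move=> cf; apply: continuous_compact_integrable; first exact: segment_compact.
exact: continuous_subspaceT.
Qed.

Lemma exists_primitive f (c : R) : continuous f ->
  exists F, forall x, c < x -> is_derive x 1 F (f x).
Proof.
move=> cf; exists (fun x => \int[leb]_(t in `[c, x]) f t) => x cx.
have [] := @continuous_FTC1_closed _ f c x (x + 1) _ _ cx (cf x).
- by rewrite ltrDl.
- exact: continuous_integrable_itv.
- by move=> dF F'; apply: DeriveDef; [exact: dF|rewrite -derive1E; exact: F'].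
Qed.

(** Integrating from minus infinity gives a primitive on the whole line, as is
    needed to build test functions. *)
Lemma exists_primitive_compact_support f a b : continuous f ->
  (forall x, ~ `[a, b]%classic x -> f x = 0) ->
  exists F, forall x, is_derive x 1 F (f x).
Proof.
move=> cf f0; exists (fun x => \int[leb]_(t in `]-oo, x]) f t) => x.
have fi : leb.-integrable setT (EFin \o f).
  rewrite (_ : EFin \o f = (EFin \o f) \_ `[a, b]); last first.
    apply/funext => y; rewrite patchE; case: ifPn => //.
    by rewrite notin_setE => /f0 /= ->.
  apply/(integrable_mkcond _ _).1 => //; exact: continuous_integrable_itv.
have [] := @continuous_FTC1 _ f -oo%O x (x + 1) _ _ _ (cf x).
- by rewrite ltrDl.
- by apply: integrableS fi.
- by rewrite ltNyr.
- by move=> dF F'; apply: DeriveDef; [exact: dF|rewrite -derive1E; exact: F'].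
Qed.

Lemma Rintegral_primitive f F a b : a < b -> continuous f ->
  (forall x, a <= x <= b -> is_derive x 1 F (f x)) ->
  \int[leb]_(x in `[a, b]) f x = F b - F a.
Proof.
move=> ab cf dF.
have cF x : a <= x <= b -> {for x, continuous F}.
  by move=> /dF xF; apply/differentiable_continuous/derivable1_diffP.
rewrite /Rintegral (@continuous_FTC2 _ f F)//.
- exact: continuous_subspaceT.
- split.
  + by move=> x /[!in_itv]/= /andP[ax xb]; have /dF[] : a <= x <= b by rewrite !ltW.
  + by apply: cvg_at_right_filter; apply: cF; rewrite lexx ltW.
  + by apply: cvg_at_left_filter; apply: cF; rewrite lexx ltW.
- move=> x /[!in_itv]/= /andP[ax xb].
  have xF : is_derive x 1 F (f x) by apply: dF; rewrite !ltW.
  by rewrite derive1E derive_val.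
Qed.

Lemma le0_derive_le f df a b : a <= b ->
  (forall x, a < x < b -> is_derive x 1 f (df x)) ->
  (forall x, a < x < b -> df x <= 0) ->
  {within `[a, b], continuous f} -> f b <= f a.
Proof.
move=> ab dF df0 cf.
apply: (@ler0_derive1_nincr _ f a b) => //.
- by move=> x /[!in_itv]/= /dF[].
- move=> x /[!in_itv]/= axb; have ? := dF _ axb.
  by rewrite derive1E derive_val df0.
Qed.

Lemma Rintegral_continuous_ge0_eq0 f a b : a < b -> continuous f ->
  (forall x, 0 <= f x) -> \int[leb]_(x in `[a, b]) f x = 0 ->
  forall x, a < x < b -> f x = 0.
Proof.
move=> ab cf f0.
have [F dF] := @exists_primitive f (a - 1) cf.
have dF' x : a <= x -> is_derive x 1 F (f x).
  by move=> ax; apply: dF; rewrite (lt_le_trans _ ax)// gtrBl.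
have dFab x : a <= x <= b -> is_derive x 1 F (f x) by move=> /andP[/dF'].
rewrite (Rintegral_primitive ab cf dFab).
move=> /eqP; rewrite subr_eq0 => /eqP Fba x /andP[ax xb].
have mono y z : a <= y -> y <= z -> F y <= F z.
  move=> ay yz; rewrite -lerN2.
  apply: (@le0_derive_le (- F) (fun x => - f x)) => //.
  - move=> t /andP[yt _]; have := dF' t (le_trans ay (ltW yt)) => ?.
    exact: is_deriveN.
  - by move=> t _; rewrite oppr_le0.
  - apply: derivable_within_continuous => t /[!in_itv]/= /andP[yt _].
    by have [? _] := dF' t (le_trans ay yt); exact: derivableN.
have Fc y : a < y < b -> F y = F a.
  move=> /andP[/ltW ay /ltW yb]; apply/eqP; rewrite eq_le; apply/andP; split.
    by rewrite -Fba mono.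
  exact: mono.
have := dF' x (ltW ax) => xF; rewrite -[f x](@derive_val _ _ _ _ _ _ _ xF).
rewrite (@near_eq_derive _ _ _ F (cst (F a))) ?oner_eq0 ?derive_cst//.
near=> y; rewrite /cst; apply: Fc; apply/andP; split.
  by near: y; exact: lt_nbhsr.
by near: y; exact: lt_nbhsl.
Unshelve. all: by end_near. Qed.

End scalar_calculus.

Section du_bois_reymond.
Context {R : realType}.
Notation leb := (@lebesgue_measure R).
Implicit Types (f F W h w phi : R -> R) (a b x T : R).

Lemma RintegralB_continuous f g a b : continuous f -> continuous g ->
  \int[leb]_(x in `[a, b]) (f x - g x) =
  \int[leb]_(x in `[a, b]) f x - \int[leb]_(x in `[a, b]) g x.
Proof. by move=> cf cg; rewrite RintegralB//; exact: continuous_integrable_itv. Qed.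

(** The test function is a primitive of [chi (W - c)], where [chi] is a positive
    bump on [(al, be)] and [c] the mean of [W] with weight [chi]; this choice of
    [c] makes the primitive vanish on the right of [be]. Testing against it gives
    that the integral of [chi (W - c)^2] is 0. *)
Let du_bois_reymond_inner W T al be : 0 < al -> al < be -> be < T -> continuous W ->
  (forall phi, test_function T phi ->
    \int[leb]_(x in `[0, T]) (derive1 phi x * W x) = 0) ->
  exists c, forall x, al < x < be -> W x = c.
Proof.
move=> al0 albe beT cW W0.
have T0 : 0 < T by rewrite (lt_trans al0)// (lt_trans albe).
pose chi x := Num.max 0 ((x - al) * (be - x)).
have cchi : continuous chi.
  move=> x; apply: (@continuous_max _ _ (cst 0) (fun x => (x - al) * (be - x))).
    exact: cst_continuous.
  by apply: cvgM; apply: cvgB; [exact: cvg_id|exact: cvg_cst|exact: cvg_cst|exact: cvg_id].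
have chi_ge0 x : 0 <= chi x by rewrite le_max lexx.
have chi_gt0 x : al < x < be -> 0 < chi x.
  by move=> /andP[ax xb]; rewrite lt_max mulr_gt0 ?orbT ?subr_gt0.
have chi0 x : ~ `[al, be]%classic x -> chi x = 0.
  rewrite /= in_itv/= => xab; apply/max_idPl.
  have [xal|alx] := ltP x al.
    by apply: mulr_le0_ge0; rewrite ?subr_le0 ?subr_ge0 ltW// (lt_trans xal).
  have [xbe|bex] := leP x be; first by case: xab; rewrite alx.
  by apply: mulr_ge0_le0; rewrite ?subr_le0 ?subr_ge0 ?alx// ltW.
have cchiW : continuous (fun x => chi x * W x).
  by move=> x; apply: cvgM; [exact: cchi|exact: cW].
have chi_neq0 : \int[leb]_(x in `[0, T]) chi x != 0.
  apply/eqP => /(Rintegral_continuous_ge0_eq0 T0 cchi chi_ge0) h.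
  have m : al < (al + be) / 2 < be by rewrite midf_lt ?midf_lt//; lra.
  have := chi_gt0 _ m; rewrite h ?ltxx//.
  by case/andP: m => m1 m2; rewrite (lt_trans al0)//= (lt_trans m2).
pose c := (\int[leb]_(x in `[0, T]) (chi x * W x)) / \int[leb]_(x in `[0, T]) chi x.
pose psi x := chi x * (W x - c).
have cpsi : continuous psi.
  by move=> x; apply: cvgM; [exact: cchi|apply: cvgB; [exact: cW|exact: cvg_cst]].
have psi0 x : ~ `[al, be]%classic x -> psi x = 0.
  by move=> /chi0; rewrite /psi => ->; rewrite mul0r.
have [F dF] := exists_primitive_compact_support cpsi psi0.
have intpsi : \int[leb]_(x in `[0, T]) psi x = 0.
  have -> : \int[leb]_(x in `[0, T]) psi x =
            \int[leb]_(x in `[0, T]) (chi x * W x - chi x * c).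
    by apply: eq_Rintegral => x _; rewrite /psi mulrBr.
  rewrite RintegralB_continuous//; last first.
    by move=> x; apply: cvgM; [exact: cchi|exact: cvg_cst].
  rewrite RintegralZr//; last exact: continuous_integrable_itv.
  by rewrite /c mulrCA divff// mulr1 subrr.
have Fcst a b : a <= b -> (forall x, a < x < b -> psi x = 0) -> F a = F b.
  move=> ab h; apply/eqP; rewrite eq_le; apply/andP; split.
    rewrite -lerN2; apply: (@le0_derive_le _ (- F) (fun x => - psi x)) => //.
    - by move=> x /h ->; rewrite oppr0.
    - by apply: derivable_within_continuous => x _; apply: derivableN; case: (dF x).
  apply: (@le0_derive_le _ F psi) => //.
  - by move=> x /h ->.
  - by apply: derivable_within_continuous => x _; case: (dF x).
have Fl x : x <= al -> F x = F al.
  move=> xal; apply: Fcst => // y /andP[_ yal]; apply: psi0 => /=.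
  by rewrite in_itv/= leNgt yal.
have Fr x : be <= x -> F be = F x.
  move=> xal; apply: Fcst => // y /andP[yal _]; apply: psi0 => /=.
  by rewrite in_itv/= [X in _ && X]leNgt yal andbF.
have Fab : F be = F al.
  rewrite (Fr T) ?ltW// -(Fl 0) ?ltW//; apply/eqP; rewrite -subr_eq0; apply/eqP.
  by rewrite -(Rintegral_primitive T0 cpsi (fun x _ => dF x)).
have dphi x : is_derive x 1 (F - cst (F al)) (psi x).
  by rewrite -[psi x]subr0; have ? := dF x; apply: is_deriveB.
have dphi1 : derive1 (F - cst (F al)) = psi.
  by apply/funext => x; have := dphi x => ?; rewrite derive1E derive_val.
have phiT : test_function T (F - cst (F al)).
  split; first by move=> x; case: (dphi x).
    by rewrite dphi1.
  exists al, be; split => // x /=; rewrite in_itv/= => xab.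
  rewrite /GRing.sub_fun/= {1}/cst; apply/eqP; rewrite subr_eq0; apply/eqP.
  have [xal|alx] := leP x al; first exact: Fl.
  have [xbe|bex] := leP x be; first by case: xab; rewrite ltW.
  by rewrite -(Fr x) ?ltW.
have := W0 _ phiT; rewrite dphi1 => intpsiW.
have cq : continuous (fun x => chi x * (W x - c) ^+ 2).
  move=> x; apply: cvgM; first exact: cchi.
  rewrite expr2; under eq_fun do rewrite expr2.
  by apply: cvgM; apply: cvgB; [exact: cW|exact: cvg_cst|exact: cW|exact: cvg_cst].
exists c => x /[dup] xab /andP[ax xb].
have : chi x * (W x - c) ^+ 2 = 0.
  apply: (@Rintegral_continuous_ge0_eq0 _ _ 0 T T0 cq).
  - by move=> y; rewrite mulr_ge0// sqr_ge0.
  - have -> : \int[leb]_(x in `[0, T]) (chi x * (W x - c) ^+ 2) =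
              \int[leb]_(x in `[0, T]) (psi x * W x - psi x * c).
      by apply: eq_Rintegral => y _; rewrite /psi; ring.
    rewrite RintegralB_continuous.
    + rewrite intpsiW RintegralZr ?intpsi//; last exact: continuous_integrable_itv.
      by rewrite mul0r subrr.
    + by move=> y; apply: cvgM; [exact: cpsi|exact: cW].
    + by move=> y; apply: cvgM; [exact: cpsi|exact: cvg_cst].
  - by rewrite (lt_trans al0)// (lt_trans xb).
move=> /eqP; rewrite mulf_eq0 gt_eqF ?chi_gt0//= sqrf_eq0 subr_eq0.
by move=> /eqP.
Qed.

Lemma du_bois_reymond W T : continuous W ->
  (forall phi, test_function T phi ->
    \int[leb]_(x in `[0, T]) (derive1 phi x * W x) = 0) ->
  forall s t, 0 < s < T -> 0 < t < T -> W s = W t.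
Proof.
move=> cW W0 s t.
wlog st : s t / s <= t.
  by move=> h sT tT; case: (leP s t) => [/h|/ltW /h] ->.
move=> /andP[s0 sT] /andP[t0 tT].
have [|||c Wc] := @du_bois_reymond_inner W T (s / 2) ((t + T) / 2) _ _ _ cW W0.
- by rewrite divr_gt0.
- lra.
- lra.
- by rewrite !Wc//; apply/andP; split; lra.
Qed.

(** Subtracting a primitive of [h] from [w] leaves a function with weak
    derivative 0. *)
Lemma weak_derivative_is_derive w h T : 0 < T -> continuous w -> continuous h ->
  (forall phi, test_function T phi ->
    \int[leb]_(x in `[0, T]) (derive1 phi x * w x) =
    - \int[leb]_(x in `[0, T]) (phi x * h x)) ->
  forall t, 0 < t < T -> is_derive t 1 w (h t).
Proof.
move=> T0 cw ch wh t /andP[t0 tT].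
have [F dF] := @exists_primitive _ h (-1) ch.
have dF' x : 0 <= x -> is_derive x 1 F (h x).
  by move=> x0; apply: dF; rewrite (lt_le_trans _ x0)// ltrN10.
(* [F] is only known to be differentiable on the right of -1; composing with
   [x |-> max x 0] makes it continuous on the whole line. *)
pose G x := F (Num.max x 0).
have cG : continuous G.
  move=> x; apply: continuous_comp.
    by apply: (@continuous_max _ _ id (cst 0)); [exact: cvg_id|exact: cvg_cst].
  apply/differentiable_continuous/derivable1_diffP.
  by have [] := dF' (Num.max x 0); rewrite ?le_max ?lexx ?orbT.
have GF x : 0 <= x -> G x = F x by move=> x0; rewrite /G; congr F; apply/max_idPl.
have cW : continuous (fun x => w x - G x).
  by move=> x; apply: cvgB; [exact: cw|exact: cG].
have W0 phi : test_function T phi ->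
    \int[leb]_(x in `[0, T]) (derive1 phi x * (w x - G x)) = 0.
  move=> /[dup] phiT [dphi cphi [a [b [a0 bT phi0]]]].
  have cphi0 : continuous phi.
    by move=> x; apply/differentiable_continuous/derivable1_diffP.
  have -> : \int[leb]_(x in `[0, T]) (derive1 phi x * (w x - G x)) =
            \int[leb]_(x in `[0, T]) (derive1 phi x * w x - derive1 phi x * G x).
    by apply: eq_Rintegral => x _; rewrite mulrBr.
  rewrite RintegralB_continuous; last 2 first.
  - by move=> x; apply: cvgM; [exact: cphi|exact: cw].
  - by move=> x; apply: cvgM; [exact: cphi|exact: cG].
  rewrite wh//.
  have phi00 : phi 0 = 0 by apply: phi0 => /=; rewrite in_itv/= leNgt a0.
  have phiT0 : phi T = 0 by apply: phi0 => /=; rewrite in_itv/= [X in _ && X]leNgt bT andbF.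
  have dLR (f : R -> R) df : (forall x, 0 < x < T -> is_derive x 1 f (df x)) ->
      continuous f -> derivable_oo_LRcontinuous f 0 T.
    move=> h1 cf; split.
    - by move=> x /[!in_itv]/= /h1[].
    - by apply: cvg_at_right_filter; exact: cf.
    - by apply: cvg_at_left_filter; exact: cf.
  have dG x : 0 < x < T -> is_derive x 1 G (h x).
    move=> /andP[x0 xT]; apply: (@near_eq_is_derive _ _ _ F); last exact/dF'/ltW.
    by near=> y; rewrite GF//; apply: ltW; near: y; exact: lt_nbhsr.
  have := @Rintegration_by_parts R phi G (derive1 phi) h 0 T T0.
  move=> ->.
  - by rewrite phi00 phiT0 !mul0r subrr sub0r opprK subrr.
  - by apply: continuous_subspaceT; exact: cphi.
  - apply: (dLR _ (derive1 phi)); last exact: cphi0.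
    by move=> x _; apply: DeriveDef; [exact: dphi|rewrite derive1E].
  - by [].
  - by apply: continuous_subspaceT; exact: ch.
  - exact: dLR dG cG.
  - by move=> x /[!in_itv]/= /dG ?; rewrite derive1E derive_val.
have Wc := du_bois_reymond cW W0.
apply: (@near_eq_is_derive _ _ _ (F + cst (w t - G t))); last first.
  by rewrite -[h t]addr0; have ? := dF' t (ltW t0); apply: is_deriveD.
near=> y.
have y0 : 0 < y by near: y; exact: lt_nbhsr.
have yT : y < T by near: y; exact: lt_nbhsl.
rewrite /GRing.add_fun/= (Wc t y); last 2 first.
- by rewrite t0.
- by rewrite y0.
rewrite [LHS]addrC. by rewrite GF ?ltW// subrK.
Unshelve. all: by end_near. Qed.

End du_bois_reymond.

(** * Bochner integrals and functionals *)

Section lower_integral.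
Import HBNNSimple.
Context {d} {S : measurableType d} {R : realType}.
Variable mu : {measure set S -> \bar R}.
Local Open Scope ereal_scope.

(** The integral of a nonnegative function is the supremum of the integrals of
    the simple functions below it, hence monotone without any measurability of
    the larger function [g]. This matters for [t |-> nX (f t - s_n t)], whose
    measurability is not part of the definition of the Bochner integral. *)
Lemma ge0_le_integral_nonmeasurable (f g : S -> \bar R) :
  (forall x, 0 <= f x) -> (forall x, f x <= g x) ->
  \int[mu]_x f x <= \int[mu]_x g x.
Proof.
move=> f0 fg; rewrite !ge0_integralTE//; last first.
  by move=> x; rewrite (le_trans _ (fg x)).
apply: ereal_sup_le => _ [h hf <-].
by exists h => // x; exact: le_trans (hf x) (fg x).
Qed.

Lemma ae_ge0_le_integral_nonmeasurable (D : set S) (f g : S -> \bar R) :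
  measurable D -> measurable_fun D f ->
  (forall x, D x -> 0 <= f x) -> (forall x, D x -> 0 <= g x) ->
  {ae mu, forall x, D x -> f x <= g x} ->
  \int[mu]_(x in D) f x <= \int[mu]_(x in D) g x.
Proof.
move=> mD mf f0 g0 [N [mN N0 fgN]].
rewrite (ge0_negligible_integral mN mD mf f0 N0).
rewrite integral_mkcond [leRHS]integral_mkcond.
apply: ge0_le_integral_nonmeasurable => x; rewrite !patchE.
  by case: ifPn => //; rewrite inE => -[/f0].
case: ifPn; rewrite ?inE.
  move=> [Dx Nx]; rewrite mem_set//; apply: contrapT => h; apply: Nx; apply: fgN => /= h'.
  by apply: h; exact: h'.
by move=> _; case: ifPn => //; rewrite inE => /g0.
Qed.

End lower_integral.

Section bochner_functional.
Context {R : realType} (V : lmodType R) (X : set V) (nX : V -> \bar R).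
Notation leb := (@lebesgue_measure R).

(** Linearity is only asked on [X]: the functionals of interest are integrals,
    which are not additive on functions that are not measurable. *)
Definition contraction_functional (L : V -> R) :=
  [/\ forall a v, X v -> L (a *: v) = a * L v,
      forall v w, X v -> X w -> L (v + w) = L v + L w
    & forall v, X v -> (`|L v|%:E <= nX v)%E].

Hypotheses (X0 : X 0) (XD : forall v w, X v -> X w -> X (v + w))
  (XZ : forall a v, X v -> X (a *: v)).
Hypotheses (nX_ge0 : forall v, (0 <= nX v)%E)
  (nXD : forall v w, (nX (v + w)%R <= nX v + nX w)%E).

Variable (L : V -> R).
Hypothesis HL : contraction_functional L.

Let XN v : X v -> X (- v). Proof. by rewrite -scaleN1r; exact: XZ. Qed.

Let XB v w : X v -> X w -> X (v - w).
Proof. by move=> Xv Xw; apply: XD => //; exact: XN. Qed.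

Lemma functionalB v w : X v -> X w -> L (v - w) = L v - L w.
Proof.
case: HL => LZ LD _ Xv Xw; rewrite LD//; last exact: XN.
by rewrite -scaleN1r LZ// mulN1r.
Qed.

Let X_sum (I : eqType) (s : seq I) (f : I -> V) :
  (forall i, i \in s -> X (f i)) -> X (\sum_(i <- s) f i).
Proof. by move=> h; rewrite big_seq; elim/big_ind : _. Qed.

Let L_sum (I : eqType) (s : seq I) (f : I -> V) :
  (forall i, i \in s -> X (f i)) -> L (\sum_(i <- s) f i) = \sum_(i <- s) L (f i).
Proof.
case: HL => LZ LD _; elim: s => [|i s IH] h.
  by rewrite !big_nil -(scale0r 0) LZ// mul0r.
rewrite !big_cons LD ?IH//; last 2 first.
- by apply: h; rewrite mem_head.
- by apply: X_sum => j js; apply: h; rewrite inE js orbT.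
- by move=> j js; apply: h; rewrite inE js orbT.
Qed.

Variable T : R.
Notation I := (`[0, T]%classic : set R).

(** The formal sum defining the Bochner integral of a simple function is mapped
    to the Lebesgue integral of its image, whether or not the sets overlap. *)
Lemma simple_functional (s : seq (set R * V)) : simple_ok X s ->
  [/\ forall t, X (simple_val s t), X (simple_int T s),
      leb.-integrable I (EFin \o (fun t => L (simple_val s t)))
    & \int[leb]_(t in I) L (simple_val s t) = L (simple_int T s)].
Proof.
move=> sok; have [LZ LD _] := HL.
have X1 t : X (simple_val s t).
  by apply: X_sum => p /sok[_ Xp]; exact: XZ.
have X2 : X (simple_int T s) by apply: X_sum => p /sok[_ Xp]; exact: XZ.
have indi A : measurable A -> leb.-integrable I (EFin \o \1_A).
  move=> mA; apply/integrableP; split; first exact/measurable_EFinP/measurable_indic.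
  have -> : (\int[leb]_(t in I) `|(\1_A t)%:E| = leb (A `&` I))%E.
    under eq_integral do rewrite gee0_abs ?lee_fin//.
    by rewrite integral_indic.
  apply: (@le_lt_trans _ _ (leb I)).
    by apply: le_measure; rewrite ?inE//; exact: measurableI.
  by rewrite lebesgue_measure_itv/=; case: ifP => // _; rewrite -EFinB ltry.
have ii p : p \in s -> leb.-integrable I (EFin \o (fun t => \1_(p.1) t * L p.2)).
  move=> /sok[mp Xp].
  rewrite (_ : _ \o _ = (fun t => (L p.2)%:E * (\1_(p.1) t)%:E)%E); last first.
    by apply/funext => t /=; rewrite -EFinM mulrC.
  by apply: integrableZl => //; exact: indi.
have eL t : L (simple_val s t) = \sum_(p <- s) \1_(p.1) t * L p.2.
  rewrite L_sum; last by move=> p /sok[_ Xp]; exact: XZ.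
  by apply: eq_big_seq => p /sok[_ Xp]; rewrite LZ.
have -> : (fun t => L (simple_val s t)) = (fun t => \sum_(p <- s) \1_(p.1) t * L p.2).
  by apply/funext => t; exact: eL.
have eI : L (simple_int T s) = \sum_(p <- s) fine (leb (p.1 `&` I)) * L p.2.
  rewrite L_sum; last by move=> p /sok[_ Xp]; exact: XZ.
  by apply: eq_big_seq => p /sok[_ Xp]; rewrite LZ.
suff [h1 h2] : leb.-integrable I (EFin \o (fun t => \sum_(p <- s) \1_(p.1) t * L p.2))
  /\ \int[leb]_(t in I) (\sum_(p <- s) \1_(p.1) t * L p.2) =
     \sum_(p <- s) fine (leb (p.1 `&` I)) * L p.2 by split=> //; rewrite h2 eI.
move: ii sok {X1 X2 eL eI}; elim: s => [|p s IH] ii sok.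
  split.
    rewrite (_ : _ \o _ = cst 0%E); first exact: integrable0.
    by apply/funext => t /=; rewrite big_nil.
  by under eq_Rintegral do rewrite big_nil; rewrite big_nil Rintegral_cst// mul0r.
have [||i1 i2] := IH.
- by move=> q qs; apply: ii; rewrite inE qs orbT.
- by move=> q qs; apply: sok; rewrite inE qs orbT.
have ip := ii _ (mem_head _ _).
have [mp Xp] := sok _ (mem_head _ _).
split.
  have := integrableD _ ip i1; rewrite (_ : (_ \+ _)%E = EFin \o
    (fun t => \sum_(q <- p :: s) \1_(q.1) t * L q.2)); first exact.
  by apply/funext => t /=; rewrite big_cons EFinD.
under eq_Rintegral do rewrite big_cons.
rewrite RintegralD// i2 big_cons; congr (_ + _).
under eq_Rintegral do rewrite mulrC.
rewrite RintegralZl//; last exact: indi.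
by rewrite mulrC; congr (_ * _); rewrite /Rintegral integral_indic.
Qed.

(** Along the approximating simple functions, the integrals of [L (F t)] and the
    values of [L] at the simple integrals differ by at most the integral of the
    norm of the error. The function [F] is a representative of the integrand [f]
    with values in [X]: the values of [f] itself need not be measurable, so that
    [L (f t)] may be meaningless. *)
Lemma bochner_functional (f F : R -> V) v :
  (forall t, I t -> X (F t)) ->
  {ae leb, forall t, I t -> nX (F t - f t) = 0%E} ->
  leb.-integrable I (EFin \o (fun t => L (F t))) ->
  is_bochner_int X nX T f v ->
  \int[leb]_(t in I) L (F t) = L v.
Proof.
move=> XF Ff iF [Xv [s [[sok _] s_int s_v]]]; have [LZ LD Ln] := HL.
have sf n := simple_functional (sok n).
have bound n : (`|\int[leb]_(t in I) L (F t) - L v|%:E <=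
    (\int[leb]_(t in I) nX (f t - simple_val (s n) t)) +
    nX (simple_int T (s n) - v))%E.
  have [X1 X2 i1 i2] := sf n.
  rewrite -(subrKA (L (simple_int T (s n)))).
  apply: (@le_trans _ _ (`|\int[leb]_(t in I) L (F t) - L (simple_int T (s n))| +
    `|L (simple_int T (s n)) - L v|)%:E); first by rewrite lee_fin ler_normD.
  rewrite EFinD; apply: leeD; last by rewrite -functionalB// Ln//; exact: XB.
  rewrite -i2 -RintegralB//.
  have i3 : leb.-integrable I (EFin \o (fun t => L (F t) - L (simple_val (s n) t))).
    have := integrableB _ iF i1; exact.
  apply: (@le_trans _ _ (\int[leb]_(t in I) `|(L (F t) - L (simple_val (s n) t))%:E|)%E).
    rewrite EFin_normr_Rintegral//; apply: le_abse_integral => //.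
    by case/integrableP : i3.
  apply: ae_ge0_le_integral_nonmeasurable => //.
    by apply: measurableT_comp => //; case/integrableP : i3.
  move: Ff; apply: filterS; first exact: (ae_filter_ringOfSetsType leb).
  move=> t h It; have {}h := h It.
  rewrite abse_EFin -functionalB//; last exact: XF.
  apply: le_trans (Ln _ _) _; first by apply: XB => //; exact: XF.
  rewrite -(subrKA (f t)).
  by apply: (le_trans (nXD _ _)); rewrite h// add0e.
have lim0 : ((\int[leb]_(t in I) nX (f t - simple_val (s n) t)) +
    nX (simple_int T (s n) - v))%E @[n --> \oo] --> 0%E.
  by rewrite -[X in _ --> X]adde0; apply: cvgeD.
apply/eqP; rewrite -subr_eq0 -normr_le0 -lee_fin.
apply: (@le_trans _ _ (limn (fun n => (\int[leb]_(t in I) nX (f t - simple_val (s n) t)) +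
    nX (simple_int T (s n) - v))%E)).
  by apply: lime_ge; [apply/cvg_ex; exists 0%E|exact: nearW].
by rewrite (cvg_lim _ lim0).
Qed.

End bochner_functional.

Section weak_derivative_functional.
Context {R : realType} (V : lmodType R) (X : set V) (nX : V -> \bar R).
Notation leb := (@lebesgue_measure R).

Hypotheses (X0 : X 0) (XD : forall v w, X v -> X w -> X (v + w))
  (XZ : forall a v, X v -> X (a *: v)).
Hypotheses (nX_ge0 : forall v, (0 <= nX v)%E)
  (nXD : forall v w, (nX (v + w)%R <= nX v + nX w)%E)
  (nXZ0 : forall a v, nX v = 0%E -> nX (a *: v) = 0%E).

Hypothesis nX_0 : nX 0 = 0%E.

Variable T : R.
Hypothesis T0 : 0 < T.
Notation I := (`[0, T]%classic : set R).

(** Functions of time are only controlled on [[0, T]]; composing them with [clip]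
    turns continuity there into continuity on the line. *)
Definition clip (t : R) : R := Num.max 0 (Num.min T t).

Lemma clip_in t : I (clip t).
Proof. by rewrite /= in_itv/= le_max lexx/= ge_max ltW//= ge_min lexx. Qed.

Lemma clip_id t : I t -> clip t = t.
Proof.
rewrite /= in_itv/= => /andP[t0 tT].
by rewrite /clip (min_idPr _)//; apply/max_idPr.
Qed.

Lemma continuous_comp_clip (f : R -> R) :
  {within I, continuous f} -> continuous (f \o clip).
Proof.
move=> /subspace_continuousP cf t.
apply: (@cvg_comp _ _ _ clip f (nbhs t) (within I (nbhs (clip t)))); last first.
  exact: (cf _ (clip_in t)).
move=> A; rewrite /within/= => hA.
have cclip : {for t, continuous clip}.
  apply: (@continuous_max _ _ (cst 0) (Num.min T)); first exact: cvg_cst.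
  by apply: (@continuous_min _ _ (cst T) id); [exact: cvg_cst|exact: cvg_id].
have : \forall s \near t, I (clip s) -> A (clip s) := cclip _ hA.
by apply: filterS => s; apply; exact: clip_in.
Qed.

Lemma continuous_functional (L : V -> R) (u : R -> V) :
  contraction_functional X nX L -> continuous_on_I X nX T u ->
  {within I, continuous (fun t => L (u t))}.
Proof.
move=> HL cu; have [LZ LD Ln] := HL.
apply/subspace_continuousP => t It; have [Xut hut] := cu _ It.
apply/cvgrPdist_lt => e e0.
have /fine_cvgP[fut /cvgrPdist_lt/(_ _ e0) lt_e] := hut.
near=> s.
have Is : I s by near: s; exact: withinT.
have [Xus _] := cu _ Is.
rewrite distrC -(functionalB XZ HL)// -lte_fin.
apply: (le_lt_trans (Ln _ (_ : X _))).
  by apply: XD => //; rewrite -scaleN1r; exact: XZ.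
have us_fin : nX (u s - u t) \is a fin_num by near: s.
rewrite -(fineK us_fin) lte_fin.
have : `|0 - (fine \o (fun s => nX (u s - u t))) s| < e by near: s.
by rewrite sub0r normrN/= ger0_norm// fine_ge0.
Unshelve. all: by end_near. Qed.

(** The weak derivative [g] is only determined up to null sets of times and
    vectors of norm 0. When one of its representatives [G] is continuous in
    time, [L (u t)] has the continuous weak derivative [L (G t)], so it is
    differentiable in the classical sense. *)
Lemma W1oo_is_derive (L : V -> R) (u g G : R -> V) :
  contraction_functional X nX L ->
  is_W1oo X nX T u g -> continuous_on_I X nX T G ->
  {ae leb, forall t, I t -> nX (g t - G t) = 0%E} ->
  forall t, 0 < t < T -> is_derive t 1 (fun t => L (u t)) (L (G t)).
Proof.
move=> HL [cu _ _ wd] cG gG t t0T; have [LZ LD Ln] := HL.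
have It : I t by rewrite /= in_itv/= !ltW//; case/andP : t0T.
have Lu := continuous_functional HL cu.
have LG := continuous_functional HL cG.
have cLu := continuous_comp_clip Lu.
have cLG := continuous_comp_clip LG.
have wint phi : test_function T phi ->
    \int[leb]_(x in I) (derive1 phi x * L (u (clip x))) =
    - \int[leb]_(x in I) (phi x * L (G (clip x))).
  move=> /[dup] phiT [dphi cphi _]; have [v v1 v2] := wd _ phiT.
  have cphi0 : continuous phi.
    by move=> x; apply/differentiable_continuous/derivable1_diffP.
  have Xv : X v by case: v1.
  have -> : \int[leb]_(x in I) (derive1 phi x * L (u (clip x))) =
            \int[leb]_(x in I) L (derive1 phi x *: u x).
    apply: eq_Rintegral => x /[!inE] Ix; rewrite LZ; last by case: (cu _ Ix).
    by rewrite clip_id.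
  have -> : \int[leb]_(x in I) (phi x * L (G (clip x))) =
            \int[leb]_(x in I) L (phi x *: G x).
    apply: eq_Rintegral => x /[!inE] Ix; rewrite LZ; last by case: (cG _ Ix).
    by rewrite clip_id.
  have int_ok (psi : R -> R) (w : R -> V) : continuous psi -> continuous_on_I X nX T w ->
      leb.-integrable I (EFin \o (fun x => L (psi x *: w x))).
    move=> cpsi cw.
    have : leb.-integrable I (EFin \o (fun x => psi x * L (w (clip x)))).
      apply: continuous_integrable_itv => x; apply: cvgM; first exact: cpsi.
      exact: continuous_comp_clip (continuous_functional HL cw) x.
    apply: eq_integrable => //.
    by move=> x /[!inE] Ix /=; rewrite LZ ?clip_id//; case: (cw _ Ix).
  rewrite (bochner_functional X0 XD XZ nX_ge0 nXD HL (f := fun x => derive1 phi x *: u x) (v := v)) //.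
  - rewrite (bochner_functional X0 XD XZ nX_ge0 nXD HL (f := fun x => phi x *: g x) (v := - v)) //.
    + by rewrite -scaleN1r LZ// mulN1r opprK.
    + by move=> x Ix; apply: XZ; case: (cG _ Ix).
    + move: gG; apply: filterS; first exact: (ae_filter_ringOfSetsType leb).
      move=> x h Ix; rewrite -scalerBr.
      have := nXZ0 (- phi x) (h Ix).
      by rewrite -opprB scalerN scaleNr opprK.
    + exact: int_ok.
  - by move=> x Ix; apply: XZ; case: (cu _ Ix).
  - by apply: aeW => x _; rewrite subrr.
  - exact: int_ok.
have := weak_derivative_is_derive T0 cLu cLG wint t0T.
rewrite /= clip_id//.
apply: near_eq_is_derive.
case/andP: t0T => t0 tT.
near=> s; rewrite /= clip_id//= in_itv/=; apply/andP; split; apply: ltW.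
  by near: s; exact: lt_nbhsr.
by near: s; exact: lt_nbhsl.
Unshelve. all: by end_near. Qed.

End weak_derivative_functional.

(** * The space X and its means *)

Section spaces.
Context {R : realType}.
Local Notation mu1 := (@mu1 R).
Local Notation mu2 := (@mu2 R).
Local Notation E1 := (measurableTypeR R).
Implicit Types (f g : R -> R) (k l : R * R -> R) (u v : @Xvec R) (C : R).

Lemma mu1E (A : set E1) : mu1 A = lebesgue_measure (A `&` `[0, 1]%classic).
Proof. by []. Qed.

Lemma mu1T : mu1 setT = 1%E.
Proof. by rewrite mu1E setTI lebesgue_measure_itv/= lte_fin ltr01 -EFinB subr0. Qed.

Lemma mu2X (A B : set E1) : measurable A -> measurable B ->
  mu2 (A `*` B) = (mu1 A * mu1 B)%E.
Proof. by move=> mA mB; rewrite /Defs.mu2 product_measure1E. Qed.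

Lemma mu2T : mu2 setT = 1%E.
Proof. by rewrite -setXTT mu2X// mu1T mule1. Qed.

Lemma mu1_gt0 : (0 < mu1 setT)%E. Proof. by rewrite mu1T lte01. Qed.
Lemma mu1_lty : (mu1 setT < +oo)%E. Proof. by rewrite mu1T ltry. Qed.
Lemma mu2_gt0 : (0 < mu2 setT)%E. Proof. by rewrite mu2T lte01. Qed.
Lemma mu2_lty : (mu2 setT < +oo)%E. Proof. by rewrite mu2T ltry. Qed.

Lemma fine_mu1_le1 (A : set E1) : measurable A -> fine (mu1 A) <= 1.
Proof.
move=> mA; have h : (mu1 A <= 1%:E)%E by rewrite -mu1T le_measure// inE.
by rewrite -lee_fin fineK// ge0_fin_numE// (le_lt_trans h)// ltry.
Qed.

Lemma fine_mu2_le1 (A : set (E1 * E1)) : measurable A -> fine (mu2 A) <= 1.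
Proof.
move=> mA; have h : (mu2 A <= 1%:E)%E by rewrite -mu2T le_measure// inE.
by rewrite -lee_fin fineK// ge0_fin_numE// (le_lt_trans h)// ltry.
Qed.

Lemma ae_mu2_fst (P : R -> Prop) : (\forall x \ae mu1, P x) ->
  \forall p \ae mu2, P p.1.
Proof.
move=> [N [mN N0 hN]]; exists (N `*` setT); split.
- exact: measurableX.
- by rewrite mu2X// N0 mul0e.
- by move=> p hp; split=> //; apply: hN.
Qed.

Lemma ae_mu2_snd (P : R -> Prop) : (\forall x \ae mu1, P x) ->
  \forall p \ae mu2, P p.2.
Proof.
move=> [N [mN N0 hN]]; exists (setT `*` N); split.
- exact: measurableX.
- by rewrite mu2X// N0 mule0.
- by move=> p hp; split=> //; apply: hN.
Qed.

Section seminorm.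
Context {d} {S : measurableType d} (mu : {measure set S -> \bar R}).
Hypotheses (mu_gt0 : (0 < mu setT)%E).
Implicit Types (h w : S -> R).

Lemma Lnorm_oo0 : ('N[mu]_+oo [EFin \o (0%R : S -> R)] = 0)%E.
Proof.
apply/eqP; rewrite eq_le Lnorm_ge0 andbT.
by apply/(Lnorm_oo_leP mu_gt0); apply: aeW => x; rewrite normr0.
Qed.

(** The values of a Bochner integrand are arbitrary representatives, so the
    triangle inequality is used for functions that may fail to be measurable. *)
Lemma Lnorm_ooD h w : ('N[mu]_+oo [EFin \o (h + w)%R] <=
  'N[mu]_+oo [EFin \o h] + 'N[mu]_+oo [EFin \o w])%E.
Proof. by rewrite !Lnorm_ooE//; exact: (ess_sup_absD mu (EFin \o h) (EFin \o w)). Qed.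

Lemma Lnorm_ooZ0 (a : R) h : ('N[mu]_+oo [EFin \o h] = 0)%E ->
  ('N[mu]_+oo [EFin \o (a *: h)%R] = 0)%E.
Proof.
move=> h0; apply/eqP; rewrite eq_le Lnorm_ge0 andbT.
have : ('N[mu]_+oo [EFin \o h] <= 0%:E)%E by rewrite h0.
move/(Lnorm_oo_leP mu_gt0) => ae0.
apply/(Lnorm_oo_leP mu_gt0); apply: filterS ae0 => x.
by rewrite normr_le0 => /eqP hx; rewrite (_ : (a *: h) x = a * h x)// hx mulr0 normr0.
Qed.

Lemma Lnorm_ooN h : ('N[mu]_+oo [EFin \o (- h)%R] = 'N[mu]_+oo [EFin \o h])%E.
Proof. by rewrite -[RHS]oppe_Lnorm. Qed.

Lemma Lfun_ooD h w : h \in Lfun mu +oo -> w \in Lfun mu +oo -> h + w \in Lfun mu +oo.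
Proof.
move=> /(Lfun_ooP _ _).1 [mh fh] /(Lfun_ooP _ _).1 [mw fw].
apply/Lfun_ooP; split; first exact: measurable_funD.
by rewrite (le_lt_trans (Lnorm_ooD _ _))// lte_add_pinfty.
Qed.

Lemma Lfun_ooZ (a : R) h : h \in Lfun mu +oo -> (a *: h) \in Lfun mu +oo.
Proof.
move=> /(Lfun_ooP _ _).1 [mh fh].
apply: (Lfun_oo_bounded mu_gt0 (C := `|a| * fine ('N[mu]_+oo [EFin \o h])%E)).
  exact: measurable_funM.
apply: filterS (Lnorm_oo_ae mu_gt0 fh) => x hx.
by rewrite (_ : (a *: h) x = a * h x)// normrM ler_wpM2l.
Qed.

Lemma Lfun_ooN h : h \in Lfun mu +oo -> - h \in Lfun mu +oo.
Proof.
move=> /(Lfun_ooP _ _).1 [mh fh]; apply/Lfun_ooP; split.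
  exact: measurableT_comp.
by rewrite Lnorm_ooN.
Qed.

End seminorm.

Lemma inX0 : inX (0 : @Xvec R).
Proof.
by split; [apply: (Lfun_oo_bounded mu1_gt0 (C := 0))|apply: (Lfun_oo_bounded mu2_gt0 (C := 0))];
  try exact: measurable_cst; apply: aeW => x; rewrite normr0.
Qed.

Lemma inXD u v : inX u -> inX v -> inX (u + v).
Proof.
move=> [u1 u2] [v1 v2]; split.
  exact: Lfun_ooD mu1_gt0 _ _ u1 v1.
exact: Lfun_ooD mu2_gt0 _ _ u2 v2.
Qed.

Lemma inXZ a u : inX u -> inX (a *: u).
Proof.
move=> [u1 u2]; split.
  exact: Lfun_ooZ mu1_gt0 _ _ u1.
exact: Lfun_ooZ mu2_gt0 _ _ u2.
Qed.

Lemma inXB u v : inX u -> inX v -> inX (u - v).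
Proof. by move=> uX vX; apply: inXD => //; rewrite -scaleN1r; exact: inXZ. Qed.

Lemma normX_ge0 u : (0 <= normX u)%E.
Proof. by rewrite adde_ge0// ?Lnorm_ge0. Qed.

Lemma normXD u v : (normX (u + v) <= normX u + normX v)%E.
Proof.
rewrite /normX addeACA; apply: leeD.
  exact: Lnorm_ooD mu1_gt0 u.1 v.1.
exact: Lnorm_ooD mu2_gt0 u.2 v.2.
Qed.

Lemma normX_eq0 u : normX u = 0%E -> norm1 u.1 = 0%E /\ norm2 u.2 = 0%E.
Proof.
move=> /eqP; rewrite /normX padde_eq0 ?Lnorm_ge0//.
by move=> /andP[/eqP -> /eqP ->].
Qed.

Lemma normXZ0 a u : normX u = 0%E -> normX (a *: u) = 0%E.
Proof.
move=> /normX_eq0[u1 u2]; rewrite /normX.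
by rewrite /norm1 (Lnorm_ooZ0 mu1_gt0 a u1) /norm2 (Lnorm_ooZ0 mu2_gt0 a u2) adde0.
Qed.

Lemma normX0 : normX (0 : @Xvec R) = 0%E.
Proof.
by rewrite /normX /norm1 /norm2 (Lnorm_oo0 mu1_gt0) (Lnorm_oo0 mu2_gt0) adde0.
Qed.

Definition mean1 (A : set R) : @Xvec R -> R := fun u => \int[mu1]_(x in A) u.1 x.
Definition mean2 (B : set (R * R)) : @Xvec R -> R :=
  fun u => \int[mu2]_(p in B) u.2 p.

Let contraction d (S : measurableType d) (mu : {measure set S -> \bar R}) (A : set S) :
  (0 < mu setT)%E -> (mu setT < +oo)%E -> measurable A -> fine (mu A) <= 1 ->
  [/\ forall (a : R) (f : S -> R), f \in Lfun mu +oo ->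
        \int[mu]_(x in A) (a * f x) = a * \int[mu]_(x in A) f x,
      forall f g : S -> R, f \in Lfun mu +oo -> g \in Lfun mu +oo ->
        \int[mu]_(x in A) (f x + g x) =
        \int[mu]_(x in A) f x + \int[mu]_(x in A) g x
    & forall f : S -> R, f \in Lfun mu +oo ->
        (`|\int[mu]_(x in A) f x|%:E <= 'N[mu]_+oo [EFin \o f])%E].
Proof.
move=> mu0 muy mA muA; split.
- move=> a f fL; rewrite RintegralZl//; exact: Lfun_oo_integrable.
- by move=> f g fL gL; rewrite RintegralD//; exact: Lfun_oo_integrable.
- move=> f fL; have [mf ff] := (Lfun_ooP _ _).1 fL.
  rewrite -[leRHS]fineK ?ge0_fin_numE ?Lnorm_ge0// lee_fin.
  apply: le_trans (le_normr_Rintegral_ae mu0 muy mA _ (Lnorm_oo_ae mu0 ff)) _.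
    exact: Lfun_oo_integrable.
  by rewrite ler_piMr// fine_ge0// Lnorm_ge0.
Qed.

Lemma contraction_mean1 (A : set E1) : measurable A ->
  contraction_functional inX normX (mean1 A).
Proof.
move=> mA.
have [h1 h2 h3] := contraction mu1_gt0 mu1_lty mA (fine_mu1_le1 mA); split.
- by move=> a v [v1 _]; exact: h1.
- by move=> v w [v1 _] [w1 _]; exact: h2.
- by move=> v [v1 _]; apply: (le_trans (h3 _ v1)); rewrite leeDl// Lnorm_ge0.
Qed.

Lemma contraction_mean2 (B : set (E1 * E1)) : measurable B ->
  contraction_functional inX normX (mean2 B).
Proof.
move=> mB.
have [h1 h2 h3] := contraction mu2_gt0 mu2_lty mB (fine_mu2_le1 mB); split.
- by move=> a v [_ v1]; exact: h1.
- by move=> v w [_ v1] [_ w1]; exact: h2.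
- by move=> v [_ v1]; apply: (le_trans (h3 _ v1)); rewrite leeDr// Lnorm_ge0.
Qed.

End spaces.

(** * Integration in one variable *)

Section inner_integral.
Context {R : realType}.
Local Notation mu1 := (@mu1 R).
Local Notation mu2 := (@mu2 R).
Local Notation E1 := (measurableTypeR R).
Implicit Types (k l : R * R -> R) (C : R).

Let k_integrable k : k \in Lfun mu2 +oo -> mu2.-integrable setT (EFin \o k).
Proof. by move=> kL; apply: (Lfun_oo_integrable mu2_gt0 mu2_lty). Qed.

Lemma ae_integrable_section k : k \in Lfun mu2 +oo ->
  \forall x \ae mu1, mu1.-integrable setT (EFin \o (fun y => k (x, y))).
Proof. by move=> /k_integrable ki; exact: (@ae_integrable1 _ _ E1 E1 R mu1 mu1 _ ki). Qed.

Lemma measurable_inner_integral k : k \in Lfun mu2 +oo ->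
  measurable_fun setT (fun x => \int[mu1]_y k (x, y)).
Proof.
move=> /k_integrable ki.
have := @measurable_fubini_F _ _ E1 E1 R mu1 mu1 _ ki.
by move=> mF; apply: (measurableT_comp _ mF).
Qed.

(** By Fubini, the mean of the inner integral over a set [A] is an integral
    over the strip above [A], so the bound on averages carries over. *)
Lemma ae_inner_integral_le k C : measurable_fun setT k ->
  (\forall p \ae mu2, `|k p| <= C) ->
  \forall x \ae mu1, `|\int[mu1]_y k (x, y)| <= C.
Proof.
move=> mk kC.
have kL := Lfun_oo_bounded mu2_gt0 mk kC.
have ki := k_integrable kL.
have mF := measurable_inner_integral kL.
have FE : ae_eq mu1 setT (EFin \o (fun x => \int[mu1]_y k (x, y)))
                         (fubini_F mu1 (EFin \o k)).
  have := ae_integrable_section kL; apply: (@filterS _ _ (ae_filter_ringOfSetsType mu1)).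
  move=> x xi _ /=.
  by rewrite /Rintegral fineK//; exact: integrable_fin_num.
have Fi : mu1.-integrable setT (EFin \o (fun x => \int[mu1]_y k (x, y))).
  have /integrableP[mG Gi] := @integrable_fubini_F _ _ E1 E1 R mu1 mu1 _ ki.
  apply/integrableP; split; first exact/measurable_EFinP.
  rewrite (@ae_eq_integral _ _ _ mu1 _ (abse \o fubini_F mu1 (EFin \o k)))//.
  - by apply: measurableT_comp => //; exact/measurable_EFinP.
  - exact: measurableT_comp.
  - move: FE; apply: (@filterS _ _ (ae_filter_ringOfSetsType mu1)) => x h /h e.
    by rewrite /comp -e.
apply: (ae_le_normr_Rintegral mu1_lty Fi) => A mA.
have mAT : measurable (A `*` setT : set (E1 * E1)) by exact: measurableX.
have -> : \int[mu1]_(x in A) (\int[mu1]_y k (x, y)) = \int[mu2]_(p in A `*` setT) k p.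
  rewrite /Rintegral [in RHS]integral_mkcond.
  rewrite -(@integral12_prod_meas1 _ _ E1 E1 R mu1 mu1); last first.
    exact/(integrable_mkcond _ _).1/(integrableS _ _ _ ki).
  rewrite [in LHS]integral_mkcond; congr fine.
  apply: ae_eq_integral => //.
  - by apply/(measurable_restrictT _ _).1 => //; apply: measurable_funTS; exact/measurable_EFinP.
  - apply: (@measurable_fubini_F _ _ E1 E1 R mu1 mu1).
    exact/(integrable_mkcond _ _).1/(integrableS _ _ _ ki).
  - move: FE; apply: (@filterS _ _ (ae_filter_ringOfSetsType mu1)).
    move=> x /(_ Logic.I) h _; rewrite patchE /fubini_F.
    case: ifPn => xA.
      rewrite -[LHS]/((EFin \o (fun x => \int[mu1]_y k (x, y))) x) h.
      apply: eq_integral => y _.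
      by rewrite patchE ifT// inE/=; split => //; exact/set_mem.
    rewrite integral0_eq// => y _; rewrite patchE ifF//.
    by apply/negP; rewrite inE => -[/= /mem_set]; rewrite (negbTE xA).
rewrite (le_trans (le_normr_Rintegral_ae mu2_gt0 mu2_lty mAT _ kC))//.
  exact: integrableS ki.
by rewrite -[Defs_mu2__canonical__measure_function_Measure _]/(mu2 _) mu2X// mu1T mule1.
Qed.

(** The difference of the inner integrals is the inner integral of the
    difference only for almost every [x], since other sections need not be
    integrable. *)
Lemma ae_inner_integralB_le k l C : k \in Lfun mu2 +oo -> l \in Lfun mu2 +oo ->
  (\forall p \ae mu2, `|k p - l p| <= C) ->
  \forall x \ae mu1, `|\int[mu1]_y k (x, y) - \int[mu1]_y l (x, y)| <= C.
Proof.
move=> kL lL h.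
have [[mk _] [ml _]] := ((Lfun_ooP _ _).1 kL, (Lfun_ooP _ _).1 lL).
have mkl : measurable_fun setT (k \- l) by exact: measurable_funB.
have := ae_inner_integral_le mkl h.
move: (ae_integrable_section kL) (ae_integrable_section lL).
apply: (@filterS3 _ _ (ae_filter_ringOfSetsType mu1)).
by move=> x ki li; rewrite -RintegralB.
Qed.

End inner_integral.

(** * Lipschitz and measurability properties of Gam and H *)

Section regularity.
Context {R : realType}.
Implicit Types (f : R -> R) (H : R * R -> R).

Lemma supnorm_ge (S : Type) (f : S -> R) (x : S) : bounded_fun f -> `|f x| <= supnorm f.
Proof.
move=> [M [Mreal hM]]; apply: sup_ubound; last by exists x.
exists (M + 1) => _ [y _ <-]; apply: hM => //; first by rewrite ltrDl.
Qed.

Lemma supnorm_ge0 (S : Type) (f : S -> R) : S -> bounded_fun f -> 0 <= supnorm f.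
Proof. by move=> x fb; rewrite (le_trans _ (supnorm_ge x fb)). Qed.

Lemma lipschitz_derive1 f C : (forall x, derivable f x 1) ->
  (forall x, `|derive1 f x| <= C) -> forall x y, `|f x - f y| <= C * `|x - y|.
Proof.
move=> df dfC.
suff h x y : y < x -> `|f x - f y| <= C * `|x - y|.
  move=> x y; have [xy|yx|->] := ltgtP x y.
  - by rewrite distrC [X in _ * X]distrC h.
  - exact: h.
  - by rewrite !subrr normr0 mulr0.
move=> yx; have [||c _ ->] := @MVT R f (derive1 f) y x yx.
- by move=> z _; apply: DeriveDef => //; rewrite derive1E.
- by apply: derivable_within_continuous => z _; exact: df.
- by rewrite normrM ler_wpM2r.
Qed.

Lemma slice1_derive H x y : derivable H (x, y) (1, 0) ->
  derivable (fun x => H (x, y)) x 1 /\ derive1 (fun x => H (x, y)) x = partial1 H (x, y).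
Proof.
rewrite /derivable derive1E /partial1 /derive.
have -> : (fun h => h^-1 *: (((fun x => H (x, y)) \o shift x) (h *: 1) - H (x, y))) =
   (fun h => h^-1 *: ((H \o shift (x, y)) (h *: (1, 0)) - H (x, y))).
  by apply/funext => h /=; congr (_ *: (H _ - _)); congr pair; rewrite /= scaler0 add0r.
by [].
Qed.

Lemma slice2_derive H x y : derivable H (x, y) (0, 1) ->
  derivable (fun y => H (x, y)) y 1 /\ derive1 (fun y => H (x, y)) y = partial2 H (x, y).
Proof.
rewrite /derivable derive1E /partial2 /derive.
have -> : (fun h => h^-1 *: (((fun y => H (x, y)) \o shift y) (h *: 1) - H (x, y))) =
   (fun h => h^-1 *: ((H \o shift (x, y)) (h *: (0, 1)) - H (x, y))).
  by apply/funext => h /=; congr (_ *: (H _ - _)); congr pair; rewrite /= scaler0 add0r.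
by [].
Qed.

Lemma Cb1_2_lipschitz H : is_Cb1_2 H -> forall x y x' y',
  `|H (x, y) - H (x', y')| <= M_DH H * (`|x - x'| + `|y - y'|).
Proof.
move=> [dH _ [_ b1 b2]] x y x' y'.
have p1 p : `|partial1 H p| <= M_DH H.
  apply: (le_trans (supnorm_ge p b1)); rewrite /M_DH.
  by move: (supnorm (partial1 H)) (supnorm (partial2 H)) => r1 r2; rewrite le_max lexx.
have p2 p : `|partial2 H p| <= M_DH H.
  apply: (le_trans (supnorm_ge p b2)); rewrite /M_DH.
  by move: (supnorm (partial1 H)) (supnorm (partial2 H)) => r1 r2; rewrite le_max lexx orbT.
have h1 : `|H (x, y) - H (x', y)| <= M_DH H * `|x - x'|.
  apply: (@lipschitz_derive1 (fun x => H (x, y))) => z.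
    by have [] := slice1_derive (dH (z, y)).1.
  by have [_ e] := slice1_derive (dH (z, y)).1; rewrite e; exact: p1.
have h2 : `|H (x', y) - H (x', y')| <= M_DH H * `|y - y'|.
  apply: (@lipschitz_derive1 (fun y => H (x', y))) => z.
    by have [] := slice2_derive (dH (x', z)).2.
  by have [_ e] := slice2_derive (dH (x', z)).2; rewrite e; exact: p2.
rewrite mulrDr -(subrKA (H (x', y))) (le_trans (ler_normD _ _))//.
exact: lerD.
Qed.

Lemma M_DH_ge0 H : is_Cb1_2 H -> 0 <= M_DH H.
Proof.
move=> [_ _ [_ b1 b2]]; rewrite /M_DH le_max; apply/orP; left.
exact: (supnorm_ge0 (0, 0) b1).
Qed.

Local Notation E1 := (measurableTypeR R).

(** [H] is the limit of [H (floor (n x) / n, y)], which is measurable because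
    its first argument takes countably many values. *)
Lemma continuous_measurable_prod H : continuous H ->
  measurable_fun setT (H : E1 * E1 -> R).
Proof.
move=> cH.
pose a (n : nat) (x : R) : R := (Num.floor (n.+1%:R * x))%:~R / n.+1%:R.
apply: (measurable_fun_cvg (h := fun n p => H (a n p.1, p.2))).
- move=> n _ B mB; rewrite setTI.
  have -> : (fun p : E1 * E1 => H (a n p.1, p.2)) @^-1` B =
    \bigcup_(z in [set: int])
      ((`[z%:~R / n.+1%:R, (z + 1)%:~R / n.+1%:R[%classic : set R) `*`
       ((fun y => H (z%:~R / n.+1%:R, y)) @^-1` B)).
    apply/seteqP; split => [[x y] /= hB|[x y] [z _ [/= xz hB]]].
      exists (Num.floor (n.+1%:R * x)) => //; split => //=.
      rewrite in_itv/= ler_pdivrMr// ltr_pdivlMr// [x * _]mulrC.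
      exact: floor_itv.
    rewrite /= /a (_ : Num.floor _ = z)//; apply/floor_def.
    by move: xz; rewrite in_itv/= ler_pdivrMr// ltr_pdivlMr// [x * _]mulrC.
  apply: countable_bigcupT_measurable; first exact: countableP.
  move=> z; apply: measurableX => //.
  rewrite -[X in measurable X]setTI.
  have : continuous (fun y => H (z%:~R / n.+1%:R, y)).
    move=> y; apply: (@continuous_comp R (R * R)%type R (fun y => (z%:~R / n.+1%:R, y)) H);
      last exact: cH.
    by apply: (@cvg_pair R R R (nbhs y) (nbhs (z%:~R / n.+1%:R : R)) (nbhs y) _ _ _
      (fun=> z%:~R / n.+1%:R) id); [exact: cvg_cst|exact: cvg_id].
  by move=> /continuous_measurable_fun; exact.
- move=> [x y] _ /=.
  apply: (@cvg_comp nat (R * R)%type R (fun n => (a n x, y)) H _ (nbhs (x, y))); last exact: cH.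
  apply: (@cvg_pair nat R R \oo (nbhs x) (nbhs y) _ _ _ (a ^~ x) (fun=> y));
    last exact: cvg_cst.
  apply/cvgrPdist_lt => e e0.
  near=> n.
  apply: (@le_lt_trans _ _ (n.+1%:R^-1)); last first.
    by near: n; exact: (near_infty_natSinv_lt (PosNum e0)).
  have /andP[] := floor_itv (n.+1%:R * x).
  rewrite -ler_pdivrMl// -ltr_pdivlMl// intrD mulrDr => h1 h2.
  rewrite /a ger0_norm ?subr_ge0 ?[_ / n.+1%:R]mulrC//.
  by rewrite lerBlDl ltW// -[X in _ + X]mulr1.
Unshelve. all: by end_near. Qed.

End regularity.

(** * The vector field of the continuum system *)

Section vector_field.
Context {R : realType} (eps : R) (Gam : R -> R) (H : R * R -> R).
Hypotheses (eps0 : 0 < eps) (hG : is_Cb1 Gam) (hH : is_Cb1_2 H).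
Local Notation mu1 := (@mu1 R).
Local Notation mu2 := (@mu2 R).
Local Notation E1 := (measurableTypeR R).
Local Notation n1 f := (fine (norm1 f)).
Local Notation n2 k := (fine (norm2 k)).
Local Notation MG := (supnorm Gam).
Local Notation LG := (supnorm (derive1 Gam)).
Local Notation MD := (M_DH H).
Local Notation rhs := (continuum_rhs eps Gam H).
Implicit Types (om : R -> R) (u v : @Xvec R).

Lemma fine_norm1_ge0 (f : R -> R) : 0 <= n1 f.
Proof. by rewrite fine_ge0// Lnorm_ge0. Qed.

Lemma fine_norm2_ge0 (k : R * R -> R) : 0 <= n2 k.
Proof. by rewrite fine_ge0// Lnorm_ge0. Qed.

Lemma norm1_ae (f : R -> R) : f \in Lfun mu1 +oo -> \forall x \ae mu1, `|f x| <= n1 f.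
Proof. by move=> /(Lfun_ooP _ _).1 [_ fy]; exact: Lnorm_oo_ae mu1_gt0 _ fy. Qed.

Lemma norm2_ae (k : R * R -> R) : k \in Lfun mu2 +oo -> \forall p \ae mu2, `|k p| <= n2 k.
Proof. by move=> /(Lfun_ooP _ _).1 [_ fy]; exact: Lnorm_oo_ae mu2_gt0 _ fy. Qed.

Lemma Gam_le x : `|Gam x| <= MG.
Proof. by case: hG => _ _ b _; exact: supnorm_ge. Qed.

Lemma Gam_lipschitz x y : `|Gam x - Gam y| <= LG * `|x - y|.
Proof.
by case: hG => dG _ _ b; apply: lipschitz_derive1 => // z; exact: supnorm_ge.
Qed.

Lemma H_le p : `|H p| <= supnorm H.
Proof. by case: hH => _ _ [b _ _]; exact: supnorm_ge. Qed.

Lemma MG_ge0 : 0 <= MG. Proof. exact: le_trans (Gam_le 0). Qed.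

Lemma LG_ge0 : 0 <= LG.
Proof. by case: hG => _ _ _ b; exact: (supnorm_ge0 0). Qed.

Let measurable_Gam : measurable_fun setT Gam.
Proof.
apply: continuous_measurable_fun => x; case: hG => dG _ _ _.
by apply/differentiable_continuous/derivable1_diffP.
Qed.

Definition coupling u : R * R -> R := fun p => u.2 p * Gam (u.1 p.2 - u.1 p.1).

Lemma coupling_Lfun u : inX u -> coupling u \in Lfun mu2 +oo.
Proof.
move=> [/[dup] u1L /(Lfun_ooP _ _).1 [mu1_ _] /[dup] u2L /(Lfun_ooP _ _).1 [mu2_ _]].
apply: (Lfun_oo_bounded mu2_gt0 (C := n2 u.2 * MG)).
  apply: measurable_funM => //; apply: measurableT_comp => //.
  apply: measurable_funB; apply: measurableT_comp => //.
have := norm2_ae u2L; apply: (@filterS _ _ (ae_filter_ringOfSetsType mu2)) => p up.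
by rewrite normrM ler_pM// Gam_le.
Qed.

Let H_comp u : inX u -> (fun p => H (u.1 p.1, u.1 p.2)) \in Lfun mu2 +oo.
Proof.
move=> [/[dup] u1L /(Lfun_ooP _ _).1 [mu1_ _] _].
apply: (Lfun_oo_bounded mu2_gt0 (C := supnorm H)); last first.
  by apply: aeW => p; exact: H_le.
apply: (@measurableT_comp _ _ _ _ _ _ (H : E1 * E1 -> R)).
  by apply: continuous_measurable_prod; case: hH => _ [].
by apply: measurable_fun_pair; apply: measurableT_comp.
Qed.

Lemma rhs_inX om u : om \in Lfun mu1 +oo -> inX u -> inX (rhs om u).
Proof.
move=> omL uX; have cL := coupling_Lfun uX; split.
  apply: (Lfun_ooD mu1_gt0) => //.
  apply: (Lfun_oo_bounded mu1_gt0 (C := n2 (coupling u))).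
    exact: (measurable_inner_integral cL).
  apply: (ae_inner_integral_le (k := coupling u)); last exact: norm2_ae.
  by case: ((Lfun_ooP _ _).1 cL).
apply: (Lfun_ooZ mu2_gt0); apply: (Lfun_ooD mu2_gt0) => //; last exact: H_comp.
exact: (Lfun_ooN uX.2).
Qed.

(** The difference is split so that only the weights of [u] appear: in the
    application they are those of the network, for which an explicit bound is
    available. *)
Lemma ae_coupling_diff u v : inX u -> inX v ->
  \forall p \ae mu2, `|coupling u p - coupling v p| <=
    MG * n2 (u.2 - v.2) + 2 * n2 u.2 * LG * n1 (u.1 - v.1).
Proof.
move=> uX vX; have [e1 e2] := inXB uX vX.
have h1 := ae_mu2_fst (norm1_ae e1); have h2 := ae_mu2_snd (norm1_ae e1).
have h3 := norm2_ae uX.2; have h4 := norm2_ae e2.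
have h12 : \forall p \ae mu2, `|(u - v).1 p.1| <= n1 (u - v).1 /\
    `|(u - v).1 p.2| <= n1 (u - v).1.
  by move: h1 h2; apply: (@filterS2 _ _ (ae_filter_ringOfSetsType mu2)).
move: h12 h3 h4; apply: (@filterS3 _ _ (ae_filter_ringOfSetsType mu2)).
move=> p [p1 p2] p4 p3; rewrite /coupling.
have -> : u.2 p * Gam (u.1 p.2 - u.1 p.1) - v.2 p * Gam (v.1 p.2 - v.1 p.1) =
  (u.2 p - v.2 p) * Gam (v.1 p.2 - v.1 p.1) +
  u.2 p * (Gam (u.1 p.2 - u.1 p.1) - Gam (v.1 p.2 - v.1 p.1)) by ring.
apply: (le_trans (ler_normD _ _)); rewrite !normrM; apply: lerD.
  by rewrite mulrC ler_pM// Gam_le.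
rewrite -!mulrA mulrCA ler_pM//; apply: (le_trans (Gam_lipschitz _ _)).
rewrite mulrCA ler_wpM2l ?LG_ge0//.
have -> : u.1 p.2 - u.1 p.1 - (v.1 p.2 - v.1 p.1) =
  (u.1 p.2 - v.1 p.2) - (u.1 p.1 - v.1 p.1) by ring.
by rewrite (le_trans (ler_normB _ _))// mulr_natl mulr2n lerD.
Qed.

Lemma ae_rhs1_diff om om' u v :
  om \in Lfun mu1 +oo -> om' \in Lfun mu1 +oo -> inX u -> inX v ->
  \forall x \ae mu1, `|(rhs om u - rhs om' v).1 x| <=
    n1 (om - om') + (MG * n2 (u.2 - v.2) + 2 * n2 u.2 * LG * n1 (u.1 - v.1)).
Proof.
move=> omL omL' uX vX.
have omd : om - om' \in Lfun mu1 +oo.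
  by apply: (Lfun_ooD mu1_gt0) => //; exact: Lfun_ooN.
have := ae_inner_integralB_le (coupling_Lfun uX) (coupling_Lfun vX) (ae_coupling_diff uX vX).
move: (norm1_ae omd).
apply: (@filterS2 _ _ (ae_filter_ringOfSetsType mu1)) => x h1 h2.
set I1 := \int[mu1]_y coupling u (x, y) in h2.
set I2 := \int[mu1]_y coupling v (x, y) in h2.
have -> : (rhs om u - rhs om' v).1 x = (om - om') x + (I1 - I2).
  have -> : (rhs om u - rhs om' v).1 x = om x + I1 - (om' x + I2) by [].
  have -> : (om - om') x = om x - om' x by [].
  by ring.
by rewrite (le_trans (ler_normD _ _))// lerD.
Qed.

Lemma ae_H_diff u v : inX u -> inX v ->
  \forall p \ae mu2, `|H (u.1 p.1, u.1 p.2) - H (v.1 p.1, v.1 p.2)| <=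
    2 * MD * n1 (u.1 - v.1).
Proof.
move=> uX vX; have [e1 _] := inXB uX vX.
have := ae_mu2_snd (norm1_ae e1); move: (ae_mu2_fst (norm1_ae e1)).
apply: (@filterS2 _ _ (ae_filter_ringOfSetsType mu2)) => p h1 h2.
apply: (le_trans (Cb1_2_lipschitz hH _ _ _ _)).
rewrite -mulrA mulrCA ler_wpM2l ?M_DH_ge0// mulr_natl mulr2n.
exact: lerD.
Qed.

Lemma rhs2E om om' u v : (rhs om u - rhs om' v).2 =
  (fun p => eps^-1 * (- (u - v).2 p +
     (H (u.1 p.1, u.1 p.2) - H (v.1 p.1, v.1 p.2)))).
Proof.
apply/funext => p.
have -> : (rhs om u - rhs om' v).2 p = eps^-1 * (- u.2 p + H (u.1 p.1, u.1 p.2)) -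
  eps^-1 * (- v.2 p + H (v.1 p.1, v.1 p.2)) by [].
have -> : (u - v).2 p = u.2 p - v.2 p by [].
by ring.
Qed.

Lemma ae_rhs2_diff om om' u v : inX u -> inX v ->
  \forall p \ae mu2, `|(rhs om u - rhs om' v).2 p| <=
    eps^-1 * (n2 (u.2 - v.2) + 2 * MD * n1 (u.1 - v.1)).
Proof.
move=> uX vX; have [_ e2] := inXB uX vX; rewrite rhs2E.
move: (norm2_ae e2) (ae_H_diff uX vX).
apply: (@filterS2 _ _ (ae_filter_ringOfSetsType mu2)) => p h1 h2.
rewrite normrM gtr0_norm ?invr_gt0// ler_pM2l ?invr_gt0//.
by rewrite (le_trans (ler_normD _ _))// lerD// normrN.
Qed.

Lemma normX_fin u : inX u -> normX u = (n1 u.1 + n2 u.2)%:E.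
Proof.
move=> [/(Lfun_ooP _ _).1 [_ h1] /(Lfun_ooP _ _).1 [_ h2]].
by rewrite EFinD !fineK// ge0_fin_numE ?Lnorm_ge0.
Qed.

Lemma normXC u v : normX (u - v) = normX (v - u).
Proof.
rewrite -(opprB v u) /normX.
by congr (_ + _)%E; [exact: Lnorm_ooN|exact: Lnorm_ooN].
Qed.

(** The Lipschitz constant of the vector field depends on the weights of its
    first argument, here frozen at time [t]; continuity at [t] needs no uniform
    bound. *)
Lemma rhs_continuous om T (u : R -> @Xvec R) : om \in Lfun mu1 +oo ->
  continuous_on_I inX normX T u ->
  continuous_on_I inX normX T (fun t => rhs om (u t)).
Proof.
move=> omL cu t It; have [utX /fine_cvgP[fut cut]] := cu _ It.
split; first exact: rhs_inX.
pose K := MG + 2 * n2 (u t).2 * LG + eps^-1 * (1 + 2 * MD).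
have [MG0 LG0 N0] := And3 MG_ge0 LG_ge0 (fine_norm2_ge0 (u t).2).
have MD0 := M_DH_ge0 hH.
have e0 : 0 <= eps^-1 by rewrite invr_ge0 ltW.
have bound s : `[0, T]%classic s ->
    (normX (rhs om (u s) - rhs om (u t)) <= (K * fine (normX (u s - u t)))%:E)%E.
  move=> Is; have [usX _] := cu _ Is.
  rewrite normXC [X in _ * fine X]normXC (normX_fin (inXB utX usX)).
  set e1 := n1 (u t - u s).1; set e2 := n2 (u t - u s).2.
  have e1_ge0 : 0 <= e1 := fine_norm1_ge0 _.
  have e2_ge0 : 0 <= e2 := fine_norm2_ge0 _.
  apply: (@le_trans _ _ ((MG * e2 + 2 * n2 (u t).2 * LG * e1) +
      eps^-1 * (e2 + 2 * MD * e1))%:E).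
    rewrite EFinD; apply: leeD.
      have := ae_rhs1_diff omL omL utX usX.
      have -> : n1 (om - om) = 0 by rewrite subrr /norm1 (Lnorm_oo0 mu1_gt0).
      by rewrite add0r; exact: (Lnorm_oo_leP mu1_gt0 _ _).2.
    apply/(Lnorm_oo_leP mu2_gt0); exact: ae_rhs2_diff.
  rewrite lee_fin /=.
  have -> : K * (e1 + e2) = MG * e2 + 2 * n2 (u t).2 * LG * e1 +
      eps^-1 * (e2 + 2 * MD * e1) + (MG * e1 + 2 * n2 (u t).2 * LG * e2 +
      eps^-1 * (e1 + 2 * MD * e2)) by rewrite /K; ring.
  by rewrite lerDl !addr_ge0// ?mulr_ge0// ?addr_ge0// ?mulr_ge0// ?mulr_ge0.
have lim0 : (K * fine (normX (u s - u t)))%:E @[s --> within `[0, T] (nbhs t)] --> 0%E.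
  apply: cvg_EFin; first exact: nearW.
  have h : K * fine (normX (u s - u t)) @[s --> within `[0, T] (nbhs t)] --> K * 0.
    by apply: cvgM; [exact: cvg_cst|exact: cut].
  by rewrite mulr0 in h.
apply: (@squeeze_cvge _ _ _ _ (fun=> 0%E) _ (fun s => (K * fine (normX (u s - u t)))%:E)) => //.
  near=> s; rewrite normX_ge0/=; apply: bound.
  by near: s; exact: withinT.
exact: cvg_cst.
Unshelve. all: by end_near. Qed.

(** The vector field evaluated along the solution is the continuous
    representative of the weak derivative that [W1oo_is_derive] asks for. *)
Lemma strong_solution_is_derive om u0 T (u : R -> @Xvec R) (L : @Xvec R -> R) :
  0 < T -> om \in Lfun mu1 +oo -> strong_solution eps Gam H om u0 T u ->
  contraction_functional inX normX L ->
  [/\ continuous_on_I inX normX T u, {within `[0, T], continuous (fun t => L (u t))} &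
  forall t, 0 < t < T -> is_derive t 1 (fun t => L (u t)) (L (rhs om (u t)))].
Proof.
move=> T0 omL [_ [g gW gE]] HL; have [cu _ _ _] := gW.
split=> //; first exact: (continuous_functional inXD inXZ normX_ge0 HL cu).
apply: (W1oo_is_derive inX0 inXD inXZ normX_ge0 normXD normXZ0 normX0 T0 HL gW _ gE).
exact: rhs_continuous.
Qed.

End vector_field.

(** * Paths differentiable against functionals *)

Section paths.
Context {R : realType}.
Implicit Types (T : R) (u v : R -> @Xvec R).

(** Common ground between strong solutions, where only the means are known to be
    differentiable, and step fields, which are differentiable in norm. *)
Definition weak_path T u (du : R -> @Xvec R) : Prop :=
  continuous_on_I inX normX T u /\
  forall t, 0 < t < T -> inX (du t) /\
    forall L, contraction_functional inX normX L ->
      is_derive t 1 (fun s => L (u s)) (L (du t)).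

Lemma cvg0_normX_le (F : set_system R) (w : R -> @Xvec R) (b : R -> \bar R) :
  Filter F -> (\forall s \near F, (normX (w s) <= b s)%E) ->
  b @ F --> 0%E -> normX (w s) @[s --> F] --> 0%E.
Proof.
move=> FF wb b0.
apply: (@squeeze_cvge _ _ _ _ (fun=> 0%E) _ b) => //; last exact: cvg_cst.
by apply: filterS wb => s ->; rewrite normX_ge0.
Qed.

Lemma continuous_on_ID T u v : continuous_on_I inX normX T u ->
  continuous_on_I inX normX T v ->
  continuous_on_I inX normX T (fun t => u t + v t).
Proof.
move=> cu cv t It; have [[uX cut] [vX cvt]] := (cu _ It, cv _ It).
split; first exact: inXD.
apply: (@cvg0_normX_le _ _ (fun s => normX (u s - u t) + normX (v s - v t))%E).
  apply: nearW => s; rewrite (_ : _ - _ = (u s - u t) + (v s - v t)) ?normXD//.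
  by rewrite opprD addrACA.
by rewrite -[X in _ --> X](adde0 0%E); apply: cvgeD.
Qed.

Lemma continuous_on_IZ T (c : R -> R) (w : @Xvec R) : inX w ->
  {within `[0, T], continuous c} ->
  continuous_on_I inX normX T (fun t => c t *: w).
Proof.
move=> wX /subspace_continuousP cc t It; split; first exact: inXZ.
have wfin : normX w = (fine (norm1 w.1) + fine (norm2 w.2))%:E by exact: normX_fin.
set K := _ + _ in wfin.
have bound (a : R) : (normX (a *: w) <= (`|a| * K)%:E)%E.
  have aX := inXZ a wX; rewrite (normX_fin aX) lee_fin mulrDr; apply: lerD.
    rewrite -lee_fin fineK; last first.
      by rewrite ge0_fin_numE ?Lnorm_ge0//; case: ((Lfun_ooP _ _).1 aX.1).
    apply/(Lnorm_oo_leP mu1_gt0).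
    move: (norm1_ae wX.1); apply: (@filterS _ _ (ae_filter_ringOfSetsType mu1)) => x h.
    by rewrite (_ : (a *: w).1 x = a * w.1 x)// normrM ler_wpM2l.
  rewrite -lee_fin fineK; last first.
    by rewrite ge0_fin_numE ?Lnorm_ge0//; case: ((Lfun_ooP _ _).1 aX.2).
  apply/(Lnorm_oo_leP mu2_gt0).
  move: (norm2_ae wX.2); apply: (@filterS _ _ (ae_filter_ringOfSetsType mu2)) => x h.
  by rewrite (_ : (a *: w).2 x = a * w.2 x)// normrM ler_wpM2l.
apply: (@cvg0_normX_le _ _ (fun s => (`|c s - c t| * K)%:E)).
  by apply: nearW => s; rewrite -scalerBl.
apply: cvg_EFin; first exact: nearW.
have h : `|c s - c t| * K @[s --> within `[0, T] (nbhs t)] --> `|c t - c t| * K.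
  apply: cvgM; last exact: cvg_cst.
  apply: cvg_norm; apply: cvgB; last exact: cvg_cst.
  exact: cc.
by rewrite subrr normr0 mul0r in h.
Qed.

Lemma weak_path_ext T u v du dv : u =1 v -> du =1 dv ->
  weak_path T u du -> weak_path T v dv.
Proof. by move=> /funext -> /funext ->. Qed.

Lemma weak_path_congr T u du dv :
  (forall t, 0 < t < T -> inX (dv t) /\ normX (du t - dv t) = 0%E) ->
  weak_path T u du -> weak_path T u dv.
Proof.
move=> h [cu hu]; split=> // t t0T.
have [dvX d0] := h _ t0T; have [duX hL] := hu _ t0T.
split=> // L /[dup] HL [_ _ Ln]; suff -> : L (dv t) = L (du t) by exact: hL.
apply/esym/eqP; rewrite -subr_eq0 -normr_le0 -lee_fin.
rewrite -(functionalB inXZ HL)//.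
by apply: (le_trans (Ln _ (inXB duX dvX))); rewrite d0.
Qed.

Lemma weak_pathD T u v du dv : weak_path T u du -> weak_path T v dv ->
  weak_path T (fun t => u t + v t) (fun t => du t + dv t).
Proof.
move=> [cu hu] [cv hv]; split; first exact: continuous_on_ID.
move=> t /[dup] t0T /andP[t0 tT].
have [duX huL] := hu _ t0T; have [dvX hvL] := hv _ t0T.
split=> [|L /[dup] HL [_ LD _]]; first exact: inXD.
rewrite LD//.
have ? := huL _ HL; have ? := hvL _ HL.
have : is_derive t 1 ((fun s => L (u s)) + (fun s => L (v s))) (L (du t) + L (dv t)).
  exact: is_deriveD.
apply: near_eq_is_derive; near=> s.
have Is : `[0, T]%classic s.
  rewrite /= in_itv/=; apply/andP; split; apply: ltW.
    by near: s; exact: lt_nbhsr.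
  by near: s; exact: lt_nbhsl.
by rewrite LD//; [case: (cu _ Is)|case: (cv _ Is)].
Unshelve. all: by end_near. Qed.

Lemma weak_pathZ T (c dc : R -> R) (w : @Xvec R) : inX w ->
  {within `[0, T], continuous c} ->
  (forall t, 0 < t < T -> is_derive t 1 c (dc t)) ->
  weak_path T (fun t => c t *: w) (fun t => dc t *: w).
Proof.
move=> wX cc hc; split; first exact: continuous_on_IZ.
move=> t /hc ct; split=> [|L [LZ _ _]]; first exact: inXZ.
rewrite LZ// (_ : (fun s => L (c s *: w)) = c * cst (L w)); last first.
  by apply/funext => s; rewrite LZ.
have := is_deriveM ct (is_derive_cst (L w) t 1).
by rewrite scaler0 add0r /= [L w *: _]mulrC.
Qed.

Lemma weak_path0 T : weak_path T (fun=> 0) (fun=> 0).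
Proof.
have h : weak_path T (fun t : R => (cst 0 t : R) *: (0 : @Xvec R))
                     (fun t : R => (cst 0 t : R) *: (0 : @Xvec R)).
  by apply: weak_pathZ => [|x]; [exact: inX0|exact: cst_continuous].
by apply: (weak_path_ext _ _ h) => t; rewrite /= scaler0.
Qed.

Lemma weak_path_sum T (I : Type) (s : seq I) (u du : I -> R -> @Xvec R) :
  (forall i, weak_path T (u i) (du i)) ->
  weak_path T (fun t => \sum_(i <- s) u i t) (fun t => \sum_(i <- s) du i t).
Proof.
move=> h; elim: s => [|i s IH].
  by apply: (weak_path_ext _ _ (weak_path0 T)) => t; rewrite big_nil.
by apply: (weak_path_ext _ _ (weak_pathD (h i) IH)) => t; rewrite big_cons.
Qed.

Lemma weak_pathB T u v du dv : weak_path T u du -> weak_path T v dv ->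
  weak_path T (fun t => u t - v t) (fun t => du t - dv t).
Proof.
move=> hu [cv hv].
have : weak_path T (fun t => - v t) (fun t => - dv t).
  split.
    move=> t It; have [vX cvt] := cv _ It.
    split; first by rewrite -scaleN1r; exact: inXZ.
    rewrite (_ : (fun s => _) = (fun s => normX (v s - v t)))//.
    by apply/funext => s; rewrite opprK addrC normXC.
  move=> t t0T; have [dvX hvL] := hv _ t0T.
  split; first by rewrite -scaleN1r; exact: inXZ.
  move=> L /[dup] HL [LZ _ _]; have ? := hvL _ HL.
  rewrite -scaleN1r LZ// mulN1r.
  have : is_derive t 1 (- (fun s => L (v s))) (- L (dv t)) by exact: is_deriveN.
  case/andP : t0T => t0 tT.
  apply: near_eq_is_derive; near=> s.
  have Is : `[0, T]%classic s.
    rewrite /= in_itv/=; apply/andP; split; apply: ltW.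
      by near: s; exact: lt_nbhsr.
    by near: s; exact: lt_nbhsl.
  by rewrite -[RHS]/(L (- v s)) -scaleN1r LZ ?mulN1r//; case: (cv _ Is).
exact: weak_pathD.
Unshelve. all: by end_near. Qed.

End paths.

(** * The scalar comparison argument *)

Section comparison.
Context {R : realType}.
Implicit Types (T t : R) (f p q : R -> R).

Lemma is_derive_expRZ (k t : R) :
  is_derive t 1 (fun s => expR (k * s)) (k * expR (k * t)).
Proof.
have h : is_derive t 1 ( *%R k) k.
  have := @is_deriveZ _ _ _ id k t 1 1 _.
  by rewrite [k *: 1]mulr1; exact.
by rewrite mulrC; exact: (is_derive1_comp (is_derive_expR (k * t)) h).
Qed.

Lemma is_derive_mulr_cst (c t : R) : is_derive t 1 (id * cst c) c.
Proof.
have := is_deriveM (is_derive_id t 1) (is_derive_cst c t 1).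
by rewrite scaler0 add0r [_ *: 1]mulr1; exact.
Qed.

Lemma is_derive_cstM (c df t : R) f :
  is_derive t 1 f df -> is_derive t 1 (cst c * f) (c * df).
Proof.
move=> h; have := is_deriveM (is_derive_cst c t 1) h.
by rewrite scaler0 addr0; exact.
Qed.

(** The differential inequality q' <= F t q in comparison form: [q] stays
    below every supersolution that starts above it. This makes sense for an
    essential supremum [q], which need not be differentiable. *)
Definition subsolution T (F : R -> R -> R) q := forall Q dQ,
  {within `[0, T], continuous Q} ->
  (forall t, 0 < t < T -> is_derive t 1 Q (dQ t)) ->
  q 0 <= Q 0 -> (forall t, 0 < t < T -> F t (Q t) <= dQ t) ->
  forall t, 0 <= t <= T -> q t <= Q t.

Lemma is_derive_within f df (a b : R) :
  (forall x : R, a <= x <= b -> is_derive x 1 f (df x)) ->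
  {within `[a, b], continuous f}.
Proof.
move=> h; apply: derivable_within_continuous => x; rewrite in_itv/= => /h.
by case.
Qed.

(** The inequalities q' <= (- q + c p) / eps and p' <= Eom + a q + b p imply the
    explicit bounds. First [q] is dominated by the solution [Q] of the equality
    case, and then [p] by a primitive [P]; these are differentiable, and the
    sum [S] of [P] and [eps a Q] satisfies Gronwall's inequality. Once [p] is below
    [B], the right-hand side of the claim on [q] is itself a supersolution,
    because [B] is nondecreasing. *)
Lemma comparison_bound T (eps a b c Eom : R) p q : 0 < T -> 0 < eps ->
  0 <= a -> 0 <= b -> 0 <= c -> 0 <= Eom ->
  (forall t, 0 <= t <= T -> 0 <= p t) -> (forall t, 0 <= t <= T -> 0 <= q t) ->
  {within `[0, T], continuous p} ->
  subsolution T (fun t y => eps^-1 * (- y + c * p t)) q ->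
  (forall Q, (forall t, 0 <= t <= T -> q t <= Q t) ->
     subsolution T (fun t _ => Eom + a * Q t + b * p t) p) ->
  let B t := expR ((b + a * c) * t) * (p 0 + t * Eom + eps * a * q 0) in
  forall t, 0 <= t <= T ->
    p t <= B t /\ q t <= expR (- t / eps) * q 0 + c * B t.
Proof.
move=> T0 eps0 a0 b0 c0 E0 p_ge0 q_ge0 cp subq subp B.
have T0T : 0 <= (0 : R) <= T by rewrite lexx ltW.
pose pc := p \o clip T.
have cpc : continuous pc := continuous_comp_clip T0 cp.
have pcE t : 0 <= t <= T -> pc t = p t.
  by move=> tT; rewrite /pc /= clip_id//= in_itv.
pose Lam := b + a * c.
have Lam0 : 0 <= Lam by rewrite addr_ge0// mulr_ge0.
have cexp k : continuous (fun s : R => expR (k * s)).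
  move=> s; have := is_derive_expRZ k s => -[+ _].
  by move=> /derivable1_diffP/differentiable_continuous.
have [J dJ] : exists J, forall x : R, -1 < x ->
    is_derive x 1 J (expR (eps^-1 * x) * (eps^-1 * c * pc x)).
  apply: exists_primitive => x; apply: cvgM; first exact: cexp.
  by apply: cvgM; [exact: cvg_cst|exact: cpc].
pose Q t := expR (- eps^-1 * t) * (q 0 + J t - J 0).
have dQ t : -1 < t -> is_derive t 1 Q (eps^-1 * (- Q t + c * pc t)).
  move=> /dJ Jt; have Et := is_derive_expRZ (- eps^-1) t.
  have Jt' : is_derive t 1 (cst (q 0) + J - cst (J 0)) (expR (eps^-1 * t) * (eps^-1 * c * pc t)).
    have := is_deriveB (is_deriveD (is_derive_cst (q 0) t 1) Jt) (is_derive_cst (J 0) t 1).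
    by rewrite add0r subr0; exact.
  have := is_deriveM Et Jt'.
  rewrite (_ : (fun s => expR (- eps^-1 * s)) * (cst (q 0) + J - cst (J 0)) = Q)//.
  move=> h; apply: (@is_derive_eq _ _ _ _ _ _ _ _ h).
  rewrite -[(cst (q 0) + J - cst (J 0)) t]/(q 0 + J t - J 0).
  rewrite /GRing.scale/= /Q mulrA -expRD mulNr addNr expR0 mul1r.
  by ring.
have neg1 t : 0 <= t -> -1 < t by move=> t0; rewrite (lt_le_trans _ t0)// ltrN10.
have dQ' t : 0 <= t <= T -> is_derive t 1 Q (eps^-1 * (- Q t + c * p t)).
  by move=> /[dup] /pcE <- /andP[/neg1 /dQ].
have cwQ : {within `[0, T], continuous Q}.
  exact: (@is_derive_within Q (fun t => eps^-1 * (- Q t + c * p t)) 0 T dQ').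
have Q0 : Q 0 = q 0 by rewrite /Q mulr0 expR0 mul1r addrK.
have oc t : 0 < t < T -> 0 <= t <= T by move=> /andP[t0 tT]; rewrite !ltW.
have qQ t : 0 <= t <= T -> q t <= Q t.
  apply: (subq _ (fun t => eps^-1 * (- Q t + c * p t)) cwQ).
  - by move=> s /oc; exact: dQ'.
  - by rewrite Q0.
  - by move=> s _.
pose Qc := Q \o clip T.
have cQc : continuous Qc by exact: (continuous_comp_clip T0 cwQ).
have QcE t : 0 <= t <= T -> Qc t = Q t.
  by move=> tT; rewrite /Qc /= clip_id//= in_itv.
have [K dK] : exists K, forall x : R, -1 < x ->
    is_derive x 1 K (Eom + a * Qc x + b * pc x).
  apply: exists_primitive => x; apply: cvgD; last first.
    by apply: cvgM; [exact: cvg_cst|exact: cpc].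
  apply: cvgD; first exact: cvg_cst.
  by apply: cvgM; [exact: cvg_cst|exact: cQc].
pose P t := p 0 + K t - K 0.
have dP t : 0 <= t <= T -> is_derive t 1 P (Eom + a * Q t + b * p t).
  move=> /[dup] tT /andP[/neg1/dK + _]; rewrite QcE// pcE// => Kt.
  have := is_deriveB (is_deriveD (is_derive_cst (p 0) t 1) Kt) (is_derive_cst (K 0) t 1).
  by rewrite add0r subr0; exact.
have cwP : {within `[0, T], continuous P}.
  exact: (@is_derive_within P (fun t => Eom + a * Q t + b * p t) 0 T dP).
have P0 : P 0 = p 0 by rewrite /P addrK.
have pP t : 0 <= t <= T -> p t <= P t.
  apply: (subp _ qQ _ (fun t => Eom + a * Q t + b * p t) cwP).
  - by move=> s /oc; exact: dP.
  - by rewrite P0.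
  - by move=> s _.
(* In [S] the coupling terms [a Q] cancel. *)
pose S t := P t + eps * a * Q t.
have dS t : 0 <= t <= T -> is_derive t 1 S (Eom + Lam * p t).
  move=> tT; have Pt := dP t tT; have Qt := dQ' t tT.
  have h : is_derive t 1 (cst (eps * a) * Q) ((eps * a) * (eps^-1 * (- Q t + c * p t))).
    exact: is_derive_cstM.
  have := @is_deriveD _ _ _ P (cst (eps * a) * Q) t 1 _ _ Pt h.
  move=> h'; apply: (@is_derive_eq _ _ _ _ _ _ _ _ h'); rewrite /Lam; field.
  by rewrite gt_eqF.
have pS t : 0 <= t <= T -> p t <= S t.
  move=> tT; rewrite (le_trans (pP _ tT))// lerDl mulr_ge0//.
    by rewrite mulr_ge0// ltW.
  exact: le_trans (q_ge0 _ tT) (qQ _ tT).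
pose D t := expR (- Lam * t) * S t - t * Eom.
have dD t : 0 <= t <= T -> is_derive t 1 D
    (expR (- Lam * t) * (Eom + Lam * (p t - S t)) - Eom).
  move=> tT; have St := dS t tT; have Et := is_derive_expRZ (- Lam) t.
  have h1 := is_deriveM Et St.
  have h2 := is_derive_mulr_cst Eom t.
  have := is_deriveB h1 h2.
  by move=> h'; apply: (@is_derive_eq _ _ _ _ _ _ _ _ h'); rewrite /GRing.scale/=; ring.
have pB t : 0 <= t <= T -> p t <= B t.
  move=> /[dup] tT /andP[t0 tT']; apply: (le_trans (pS _ tT)).
  have : D t <= D 0.
    have sub s : 0 <= s <= t -> 0 <= s <= T.
      by move=> /andP[-> st]; rewrite (le_trans st).
    pose dDs (s : R) : R := expR (- Lam * s) * (Eom + Lam * (p s - S s)) - Eom.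
    apply: (@le0_derive_le _ D dDs 0 t t0).
    - by move=> s /andP[s0 st]; apply: dD; apply: sub; rewrite !ltW.
    - move=> s /andP[s0 st]; have sT : 0 <= s <= T by rewrite ltW//= (le_trans (ltW st)).
      rewrite /dDs subr_le0 (@le_trans _ _ (expR (- Lam * s) * Eom))//.
        by rewrite ler_pM2l ?expR_gt0// gerDl mulr_ge0_le0// subr_le0 pS.
      by rewrite ler_piMl// -expR0 ler_expR mulNr oppr_le0 mulr_ge0// ltW.
    - by apply: (@is_derive_within D dDs) => s /sub/dD.
  rewrite /D mulr0 expR0 mul0r subr0 mul1r lerBlDr /S P0 Q0 => h.
  have -> : P t + eps * a * Q t = expR (Lam * t) * (expR (- Lam * t) * (P t + eps * a * Q t)).
    by rewrite mulrA -expRD mulNr addrN expR0 mul1r.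
  rewrite /B ler_pM2l ?expR_gt0//.
  by apply: (le_trans h); rewrite le_eqVlt; apply/orP; left; apply/eqP; ring.
move=> t tT; split; first exact: pB.
have En0 (s : R) : 0 <= s -> 0 <= p 0 + s * Eom + eps * a * q 0.
  by move=> s0; rewrite !addr_ge0 ?p_ge0 ?mulr_ge0 ?q_ge0// ltW.
pose dB (s : R) : R := Lam * expR (Lam * s) * (p 0 + s * Eom + eps * a * q 0) + expR (Lam * s) * Eom.
have hB (s : R) : is_derive s 1 B (dB s).
  have Et := is_derive_expRZ Lam s.
  have h2 := is_derive_mulr_cst Eom s.
  have h3 : is_derive s 1 (cst (p 0) + id * cst Eom + cst (eps * a * q 0)) Eom.
    have := is_deriveD (is_deriveD (is_derive_cst (p 0) s 1) h2)
      (is_derive_cst (eps * a * q 0) s 1).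
    by rewrite add0r addr0; exact.
  have := is_deriveM Et h3.
  by move=> h'; apply: (@is_derive_eq _ _ _ _ _ _ _ _ h');
    rewrite -[(cst (p 0) + _ + _) s]/(p 0 + s * Eom + eps * a * q 0) /dB /GRing.scale/=; ring.
pose Qb (s : R) : R := expR (- eps^-1 * s) * q 0 + c * B s.
have dQb (s : R) : is_derive s 1 Qb (- eps^-1 * expR (- eps^-1 * s) * q 0 + c * dB s).
  have h1 := is_deriveM (is_derive_expRZ (- eps^-1) s) (is_derive_cst (q 0) s 1).
  have h2 := is_deriveM (is_derive_cst c s 1) (hB s).
  have := is_deriveD h1 h2.
  by move=> h'; apply: (@is_derive_eq _ _ _ _ _ _ _ _ h'); rewrite /GRing.scale/=; ring.
have -> : - t / eps = - eps^-1 * t by rewrite mulNr mulrC mulNr.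
apply: (subq Qb (fun s => - eps^-1 * expR (- eps^-1 * s) * q 0 + c * dB s)) => //.
- by apply: (is_derive_within (df := fun s : R => - eps^-1 * expR (- eps^-1 * s) * q 0 + c * dB s)) => s _.
- by rewrite /Qb mulr0 expR0 mul1r lerDl mulr_ge0// mulr_ge0 ?expR_ge0// En0.
- move=> s /[dup] /andP[s0 _] /oc sT; rewrite /Qb.
  have -> : eps^-1 * (- (expR (- eps^-1 * s) * q 0 + c * B s) + c * p s) =
    - eps^-1 * expR (- eps^-1 * s) * q 0 + eps^-1 * c * (p s - B s) by ring.
  rewrite lerD2l (@le_trans _ _ 0)//.
    by rewrite mulr_ge0_le0 ?subr_le0 ?pB// mulr_ge0// invr_ge0 ltW.
  rewrite mulr_ge0// addr_ge0// ?mulr_ge0 ?expR_ge0//.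
  exact/En0/ltW.
Qed.

End comparison.

(** * Stability of the continuum system *)

Section family_subsolution.
Context {R : realType}.
Variables (T lam : R) (G : R -> R).

Let one_sided (w dw Q dQ : R -> R) (m : R) : 0 <= m ->
  {within `[0, T], continuous w} -> {within `[0, T], continuous Q} ->
  (forall t, 0 < t < T -> is_derive t 1 w (dw t)) ->
  (forall t, 0 < t < T -> is_derive t 1 Q (dQ t)) ->
  (forall t, 0 < t < T -> dw t + lam * w t <= m * G t) ->
  (forall t, 0 < t < T -> - lam * Q t + G t <= dQ t) ->
  w 0 <= m * Q 0 ->
  forall t, 0 <= t <= T -> w t <= m * Q t.
Proof.
move=> m0 cw cQ hw hQ wG QG w0 t /andP[t0 tT].
pose f s := expR (lam * s) * (w s - m * Q s).
pose df s := expR (lam * s) * (lam * (w s - m * Q s) + (dw s - m * dQ s)).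
have sub s : 0 < s < t -> 0 < s < T.
  by move=> /andP[-> st]; rewrite (lt_le_trans st).
have Itt : `[0, t] `<=` `[0, T] by apply: subset_itvl; rewrite bnd_simp.
have hf s : 0 < s < t -> is_derive s 1 f (df s).
  move=> /sub sT; have ws := hw _ sT; have Qs := hQ _ sT.
  have Qm : is_derive s 1 (cst m * Q) (m * dQ s).
    exact: is_derive_cstM.
  have h := is_deriveM (is_derive_expRZ lam s) (is_deriveB ws Qm).
  apply: (@is_derive_eq _ _ _ _ _ _ _ _ h).
  by rewrite -[(w - _) s]/(w s - m * Q s) /df /GRing.scale/=; ring.
have : f t <= f 0.
  apply: (@le0_derive_le _ f df 0 t t0 hf).
    move=> s /sub sT; rewrite /df pmulr_rle0 ?expR_gt0//.
    have := wG _ sT; have := ler_wpM2l m0 (QG _ sT).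
    by rewrite mulrDr; lra.
  have cf : {within `[0, t], continuous ((fun s => expR (lam * s)) \* (w \- (cst m \* Q)))}.
    apply: (@continuous_subspaceW _ _ _ `[0, T]) => //.
    move=> x; apply: cvgM.
      apply: continuous_subspaceT => y; have [+ _] := is_derive_expRZ lam y.
      by move=> /derivable1_diffP/differentiable_continuous.
    by apply: cvgB; [exact: cw|apply: cvgM; [exact: cvg_cst|exact: cQ]].
  exact: cf.
rewrite /f mulr0 expR0 mul1r => h.
rewrite -subr_le0 -(pmulr_rle0 _ (expR_gt0 (lam * t))) (le_trans h)//.
by rewrite subr_le0.
Qed.

(** If every [w i] satisfies the inequality with a forcing proportional to
    its weight [m i], then it stays below [m i] times any supersolution, and so
    the normalized supremum [q] stays below the supersolution. In the
    application [i] is a measurable set, [m i] its measure and [w i] the integral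
    over it. *)
Lemma family_subsolution (I : Type) (w dw : I -> R -> R) (m : I -> R) (q : R -> R) :
  (forall i, 0 <= m i) ->
  (forall i, {within `[0, T], continuous (w i)}) ->
  (forall i t, 0 < t < T -> is_derive t 1 (w i) (dw i t)) ->
  (forall i t, 0 < t < T -> `|dw i t + lam * w i t| <= m i * G t) ->
  (forall i, `|w i 0| <= m i * q 0) ->
  (forall t C, 0 <= t <= T -> (forall i, `|w i t| <= m i * C) -> q t <= C) ->
  subsolution T (fun t y => - lam * y + G t) q.
Proof.
move=> m0 cw hw wG w0 qw Q dQ cQ hQ Q0 QG t tT; apply: qw => // i.
have w0' : `|w i 0| <= m i * Q 0 by rewrite (le_trans (w0 _))// ler_wpM2l.
have up : w i t <= m i * Q t.
  apply: (one_sided (m0 i) (cw i) cQ (hw i) hQ _ QG) => //.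
    by move=> s sT; rewrite (le_trans (ler_norm _))// wG.
  by rewrite (le_trans (ler_norm _)).
have cwN : {within `[0, T], continuous (- w i)}.
  by move=> x; apply: cvgN; exact: cw.
have hwN s : 0 < s < T -> is_derive s 1 (- w i) (- dw i s).
  by move=> /hw ?; exact: is_deriveN.
have dn : - w i t <= m i * Q t.
  apply: (one_sided (m0 i) cwN cQ hwN hQ _ QG) => //.
    move=> s sT; rewrite -[(- w i) s]/(- w i s) mulrN -opprD.
    by rewrite (le_trans (ler_norm _))// normrN wG.
  by rewrite -[(- w i) 0]/(- w i 0) (le_trans (ler_norm _))// normrN.
by rewrite ler_norml lerNl dn up.
Qed.

End family_subsolution.

Section stability.
Context {R : realType} (eps : R) (Gam : R -> R) (H : R * R -> R).
Hypotheses (eps0 : 0 < eps) (hG : is_Cb1 Gam) (hH : is_Cb1_2 H).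
Local Notation mu1 := (@mu1 R).
Local Notation mu2 := (@mu2 R).
Local Notation E1 := (measurableTypeR R).
Local Notation n1 f := (fine (norm1 f)).
Local Notation n2 k := (fine (norm2 k)).
Local Notation MG := (supnorm Gam).
Local Notation LG := (supnorm (derive1 Gam)).
Local Notation MD := (M_DH H).
Local Notation rhs := (continuum_rhs eps Gam H).

Lemma norm1_le_mean (u : @Xvec R) C : inX u ->
  (forall A : set E1, measurable A -> `|mean1 A u| <= fine (mu1 A) * C) ->
  (norm1 u.1 <= C%:E)%E.
Proof.
move=> uX h; apply/(Lnorm_oo_leP mu1_gt0).
apply: (ae_le_normr_Rintegral mu1_lty).
  by apply: (Lfun_oo_integrable mu1_gt0 mu1_lty) => //; exact: uX.1.
by move=> A mA; rewrite mulrC; exact: h.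
Qed.

Lemma norm2_le_mean (u : @Xvec R) C : inX u ->
  (forall B : set (E1 * E1), measurable B -> `|mean2 B u| <= fine (mu2 B) * C) ->
  (norm2 u.2 <= C%:E)%E.
Proof.
move=> uX h; apply/(Lnorm_oo_leP mu2_gt0).
apply: (ae_le_normr_Rintegral mu2_lty).
  by apply: (Lfun_oo_integrable mu2_gt0 mu2_lty) => //; exact: uX.2.
by move=> A mA; rewrite mulrC; exact: h.
Qed.

Lemma mean1_le (u : @Xvec R) C (A : set E1) : inX u -> measurable A ->
  (\forall x \ae mu1, `|u.1 x| <= C) -> `|mean1 A u| <= fine (mu1 A) * C.
Proof.
move=> uX mA h; rewrite mulrC.
apply: (le_normr_Rintegral_ae mu1_gt0 mu1_lty mA _ h).
by apply: (Lfun_oo_integrable mu1_gt0 mu1_lty) => //; exact: uX.1.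
Qed.

Lemma mean2_le (u : @Xvec R) C (B : set (E1 * E1)) : inX u -> measurable B ->
  (\forall p \ae mu2, `|u.2 p| <= C) -> `|mean2 B u| <= fine (mu2 B) * C.
Proof.
move=> uX mB h; rewrite mulrC.
apply: (le_normr_Rintegral_ae mu2_gt0 mu2_lty mB _ h).
by apply: (Lfun_oo_integrable mu2_gt0 mu2_lty) => //; exact: uX.2.
Qed.

Lemma norm1_fineK (u : @Xvec R) : inX u -> norm1 u.1 = (n1 u.1)%:E.
Proof.
by move=> [/(Lfun_ooP _ _).1 [_ h1] _]; rewrite fineK// ge0_fin_numE ?Lnorm_ge0.
Qed.

Lemma norm2_fineK (u : @Xvec R) : inX u -> norm2 u.2 = (n2 u.2)%:E.
Proof.
by move=> [_ /(Lfun_ooP _ _).1 [_ h1]]; rewrite fineK// ge0_fin_numE ?Lnorm_ge0.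
Qed.

Lemma fine_norm1_continuous T (e : R -> @Xvec R) : continuous_on_I inX normX T e ->
  {within `[0, T], continuous (fun t => n1 (e t).1)}.
Proof.
move=> ce; apply/subspace_continuousP => t It; have [etX /fine_cvgP[_ cet]] := ce _ It.
apply/cvgrPdist_lt => d d0; move/cvgrPdist_lt : cet => /(_ _ d0) lt_d.
near=> s.
have Is : `[0, T]%classic s by near: s; exact: withinT.
have [esX _] := ce _ Is.
have dX := inXB esX etX.
have tri (v w : @Xvec R) : inX v -> inX w -> n1 v.1 - n1 w.1 <= n1 (v - w).1.
  move=> vX wX; rewrite lerBlDr -lee_fin EFinD -!norm1_fineK//; last exact: inXB.
  have := Lnorm_ooD mu1_gt0 (v - w).1 w.1.
  by rewrite -[X in EFin \o X]/((v - w + w).1) subrK.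
have : `|0 - (fine \o (fun s => normX (e s - e t))) s| < d by near: s.
rewrite sub0r normrN/= normX_fin//= ger0_norm ?addr_ge0 ?fine_norm1_ge0 ?fine_norm2_ge0//.
apply: le_lt_trans; rewrite (@le_trans _ _ (n1 (e s - e t).1))//; last first.
  by rewrite lerDl fine_norm2_ge0.
rewrite ler_norml lerNl opprB tri//= (le_trans (tri _ _ etX esX))//.
have -> : (e t - e s).1 = - (e s - e t).1 by rewrite -[RHS]/((- (e s - e t)).1) opprB.
by rewrite /norm1 Lnorm_ooN.
Unshelve. all: by end_near. Qed.

(** The damping term of the weight equation is kept on the left ([lam] is the
    inverse of [eps]), while the phase equation is treated as pure forcing
    ([lam = 0]); this is what makes the growth rate independent of [eps]. *)
Lemma stability T (om om' : R -> R) (Ra : R) (u v : R -> @Xvec R) : 0 < T ->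
  om \in Lfun mu1 +oo -> om' \in Lfun mu1 +oo ->
  weak_path T u (fun t => rhs om (u t)) ->
  weak_path T v (fun t => rhs om' (v t)) ->
  (forall t, 0 <= t <= T -> n2 (u t).2 <= Ra) ->
  let Lam := Lambda_star Gam H Ra in
  let e t := u t - v t in
  let B t := expR (Lam * t) *
    (n1 (e 0).1 + t * n1 (om - om') + eps * MG * n2 (e 0).2) in
  forall t, 0 <= t <= T ->
    n1 (e t).1 <= B t /\ n2 (e t).2 <= expR (- t / eps) * n2 (e 0).2 + 2 * MD * B t.
Proof.
move=> T0 omL omL' hu hv uRa Lam e B.
have [ce he] := weak_pathB hu hv.
have inI t : 0 <= t <= T -> `[0, T]%classic t by rewrite /= in_itv.
have oc t : 0 < t < T -> 0 <= t <= T by move=> /andP[t0 tT]; rewrite !ltW.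
have eX t : 0 <= t <= T -> inX (e t) by move=> /inI/ce[].
have uX t : 0 <= t <= T -> inX (u t) by move=> /inI/(hu.1)[].
have vX t : 0 <= t <= T -> inX (v t) by move=> /inI/(hv.1)[].
have T00 : 0 <= (0 : R) <= T by rewrite lexx ltW.
have Ra0 : 0 <= Ra by rewrite (le_trans _ (uRa _ T00))// fine_norm2_ge0.
have MD0 := M_DH_ge0 hH; have MG0 := MG_ge0 hG; have LG0 := LG_ge0 hG.
have subq : subsolution T (fun t y => eps^-1 * (- y + 2 * MD * n1 (e t).1))
    (fun t => n2 (e t).2).
  have -> : (fun t y => eps^-1 * (- y + 2 * MD * n1 (e t).1)) =
      (fun t y => - eps^-1 * y + eps^-1 * (2 * MD * n1 (e t).1)).
    by apply/funext => t; apply/funext => y; ring.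
  apply: (@family_subsolution _ T eps^-1 _ {B : set (E1 * E1) | measurable B}
    (fun B t => mean2 (sval B) (e t))
    (fun B t => mean2 (sval B) (rhs om (u t) - rhs om' (v t)))
    (fun B => fine (mu2 (sval B)))).
  - by move=> [A mA] /=; rewrite fine_ge0.
  - move=> [A mA] /=.
    exact: (continuous_functional inXD inXZ normX_ge0 (contraction_mean2 mA) ce).
  - by move=> [A mA] t tT /=; apply: (he _ tT).2; exact: contraction_mean2.
  - move=> [A mA] t tT /=; have [LZ LD _] := contraction_mean2 mA.
    rewrite -LZ; last exact/eX/oc.
    rewrite -LD; [|exact: (he _ tT).1|exact/inXZ/eX/oc].
    apply: mean2_le => //.
      by apply: inXD; [exact: (he _ tT).1|exact/inXZ/eX/oc].
    have := ae_H_diff hH (uX _ (oc _ tT)) (vX _ (oc _ tT)).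
    apply: (@filterS _ _ (ae_filter_ringOfSetsType mu2)) => p hp.
    have -> : (rhs om (u t) - rhs om' (v t) + eps^-1 *: e t).2 p =
      eps^-1 * (H ((u t).1 p.1, (u t).1 p.2) - H ((v t).1 p.1, (v t).1 p.2)).
      rewrite -[LHS]/((rhs om (u t) - rhs om' (v t)).2 p + eps^-1 * (e t).2 p) rhs2E.
      by rewrite -[e t]/(u t - v t); ring.
    by rewrite normrM gtr0_norm ?invr_gt0// ler_pM2l ?invr_gt0.
  - move=> [A mA] /=; apply: mean2_le => //; first exact: eX.
    exact: norm2_ae (eX _ T00).2.
  - move=> t C tT h; rewrite -lee_fin -norm2_fineK; last exact: eX.
    by apply: norm2_le_mean => [|A mA]; [exact: eX|exact: (h (exist _ A mA))].
have subp Q : (forall t, 0 <= t <= T -> n2 (e t).2 <= Q t) ->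
    subsolution T (fun t _ => n1 (om - om') + MG * Q t + 2 * Ra * LG * n1 (e t).1)
      (fun t => n1 (e t).1).
  move=> qQ.
  have -> : (fun t (_ : R) => n1 (om - om') + MG * Q t + 2 * Ra * LG * n1 (e t).1) =
      (fun t y => - 0 * y + (n1 (om - om') + MG * Q t + 2 * Ra * LG * n1 (e t).1)).
    by apply/funext => t; apply/funext => y; ring.
  apply: (@family_subsolution _ T 0 _ {A : set E1 | measurable A}
    (fun A t => mean1 (sval A) (e t))
    (fun A t => mean1 (sval A) (rhs om (u t) - rhs om' (v t)))
    (fun A => fine (mu1 (sval A)))).
  - by move=> [A mA] /=; rewrite fine_ge0.
  - move=> [A mA] /=.
    exact: (continuous_functional inXD inXZ normX_ge0 (contraction_mean1 mA) ce).
  - by move=> [A mA] t tT /=; apply: (he _ tT).2; exact: contraction_mean1.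
  - move=> [A mA] t tT /=; rewrite mul0r addr0.
    apply: mean1_le => //; first exact: (he _ tT).1.
    have := ae_rhs1_diff eps H hG omL omL' (uX _ (oc _ tT)) (vX _ (oc _ tT)).
    apply: (@filterS _ _ (ae_filter_ringOfSetsType mu1)) => x hx.
    apply: (le_trans hx); rewrite addrA.
    apply: lerD; first by rewrite lerD2l ler_wpM2l// qQ// oc.
    rewrite ler_wpM2r ?fine_norm1_ge0// ler_wpM2r// ler_wpM2l//.
    exact/uRa/oc.
  - move=> [A mA] /=; apply: mean1_le => //; first exact: eX.
    exact: norm1_ae (eX _ T00).1.
  - move=> t C tT h; rewrite -lee_fin -norm1_fineK; last exact: eX.
    by apply: norm1_le_mean => [|A mA]; [exact: eX|exact: (h (exist _ A mA))].
have := @comparison_bound _ T eps MG (2 * Ra * LG) (2 * MD) (n1 (om - om'))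
  (fun t => n1 (e t).1) (fun t => n2 (e t).2) T0 eps0 MG0 _ _ (fine_norm1_ge0 _)
  (fun _ _ => fine_norm1_ge0 _) (fun _ _ => fine_norm2_ge0 _)
  (fine_norm1_continuous ce) subq subp.
have -> : 2 * Ra * LG + MG * (2 * MD) = Lam by rewrite /Lam /Lambda_star; ring.
by apply; rewrite mulr_ge0// mulr_ge0.
Qed.

End stability.

(** * Step fields *)

Section cells.
Context {R : realType} (N : nat).
Hypothesis N0 : (0 < N)%N.
Local Notation mu1 := (@mu1 R).
Local Notation mu2 := (@mu2 R).
Local Notation E1 := (measurableTypeR R).
Local Notation cell := (@cell R N).
Implicit Types (c : 'I_N -> R) (d : 'I_N -> 'I_N -> R).

Let NR0 : 0 < N%:R :> R. Proof. by rewrite ltr0n. Qed.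

Lemma measurable_cell i : measurable (cell i : set E1).
Proof. by rewrite /Defs.cell; case: ifP => _; exact: measurable_itv. Qed.

Lemma cell_le (i : 'I_N) x : cell i x -> 0 <= x <= i.+1%:R / N%:R.
Proof.
rewrite /Defs.cell; case: ifPn => [/eqP -> /=|i0 /=]; rewrite in_itv/= ?div1r// => /andP[h ->].
by rewrite andbT (le_trans _ (ltW h))// divr_ge0.
Qed.

Lemma cell_gt (i : 'I_N) x : (0 < i)%N -> cell i x -> i%:R / N%:R < x.
Proof.
by rewrite /Defs.cell lt0n => /negbTE -> /=; rewrite in_itv/= => /andP[].
Qed.

Lemma cell_inj (i j : 'I_N) x : cell i x -> cell j x -> i = j.
Proof.
wlog ij : i j / (i <= j)%N.
  by move=> h; case: (leqP i j) => [/h//|/ltnW /h h1 hi hj]; rewrite h1.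
move: ij; rewrite leq_eqVlt => /predU1P[/val_inj//|ij] ix jx.
have := cell_gt (leq_ltn_trans (leq0n i) ij) jx.
have /andP[_ xi] := cell_le ix.
rewrite ltNge (le_trans xi)// ler_pM2r ?invr_gt0//.
by rewrite ler_nat.
Qed.

Lemma cell_cover x : 0 <= x <= 1 -> exists i, cell i x.
Proof.
move=> /andP[x0 x1].
have h n : (n < N)%N -> x <= n.+1%:R / N%:R -> exists i, cell i x.
  elim: n => [|n IH] nN xn.
    exists (Ordinal nN); rewrite /Defs.cell/= in_itv/= x0/=.
    by rewrite -div1r.
  have [xn'|xn'] := leP x (n.+1%:R / N%:R); first exact: IH (ltnW nN) xn'.
  by exists (Ordinal nN); rewrite /Defs.cell/= in_itv/= xn'.
apply: (h N.-1); rewrite prednK//.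
by rewrite divff// gt_eqF.
Qed.

Lemma ae_cell : \forall x \ae mu1, exists i, cell i x.
Proof.
exists (~` `[0, 1]%classic); split.
- by apply: measurableC; exact: measurable_itv.
- by rewrite mu1E setICl measure0.
- by move=> x /= h /= x01; apply: h; apply: cell_cover; rewrite in_itv/= in x01.
Qed.

Lemma mu1_cell i : mu1 (cell i) = (N%:R^-1)%:E.
Proof.
rewrite mu1E setIidl; last first.
  move=> x /cell_le /andP[x0 xi]; rewrite /= in_itv/= x0 (le_trans xi)//.
  by rewrite ler_pdivrMr// mul1r ler_nat.
rewrite /Defs.cell; case: ifPn => _; rewrite lebesgue_measure_itv/= lte_fin.
  by rewrite invr_gt0 NR0 -EFinB subr0.
rewrite ltr_pM2r ?invr_gt0// ltr_nat ltnSn -EFinB -mulrBl.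
by rewrite -natrB// subSnn mul1r.
Qed.

Lemma step1_cell c i x : cell i x -> step1 c x = c i.
Proof.
move=> ix; rewrite /step1 (bigD1 i)//= big1 ?addr0.
  by rewrite indicE mem_set// mulr1.
move=> j ji; rewrite indicE memNset ?mulr0// => jx.
by move: ji; rewrite (cell_inj jx ix) eqxx.
Qed.

Lemma step2_row d i x y : cell i x -> step2 d (x, y) = step1 (d i) y.
Proof.
move=> ix; rewrite -(step1_cell (fun i => step1 (d i) y) ix).
rewrite /step2 /step1; apply: eq_bigr => k _; rewrite mulr_suml.
by apply: eq_bigr => l _; rewrite -mulrA [X in d k l * X]mulrC.
Qed.

Lemma step1_out c x : (forall i, ~ cell i x) -> step1 c x = 0.
Proof.
by move=> h; rewrite /step1 big1// => i _; rewrite indicE memNset ?mulr0.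
Qed.

Lemma step2_cell d i j x y : cell i x -> cell j y -> step2 d (x, y) = d i j.
Proof.
by move=> ix jy; rewrite (step2_row _ _ ix) (step1_cell _ jy).
Qed.

Lemma Rintegral_step1 c : \int[mu1]_y step1 c y = N%:R^-1 * \sum_i c i.
Proof.
have ii i : mu1.-integrable setT (EFin \o (fun x => c i * \1_(cell i) x)).
  apply: (Lfun_oo_integrable mu1_gt0 mu1_lty) => //.
  apply: (Lfun_oo_bounded mu1_gt0 (C := `|c i|)).
    by apply: measurable_funM => //; exact: measurable_indic (measurable_cell i).
  by apply: aeW => x; rewrite normrM ler_piMr// indicE; case: (_ \in _); rewrite ?normr1 ?normr0.
rewrite /Rintegral; under eq_integral do rewrite /step1 -sumEFin.
rewrite (@integral_sum _ _ _ mu1 setT measurableT _ (fun i x => (c i * \1_(cell i) x)%:E))//.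
rewrite (eq_bigr (fun i => (N%:R^-1 * c i)%:E)); last first.
  move=> i _; under eq_integral do rewrite EFinM.
  rewrite integralZl//; last first.
    apply: (Lfun_oo_integrable mu1_gt0 mu1_lty) => //.
    apply: (Lfun_oo_bounded mu1_gt0 (C := 1)).
      exact: measurable_indic (measurable_cell i).
    by apply: aeW => x; rewrite indicE; case: (_ \in _); rewrite ?normr1 ?normr0.
  rewrite integral_indic ?setIT//; last exact: measurable_cell.
  by rewrite -[Defs_mu1__canonical__measure_function_Measure _]/(mu1 _) mu1_cell -EFinM mulrC.
by rewrite sumEFin mulr_sumr.
Qed.

Definition cell_vec1 (i : 'I_N) : @Xvec R := (\1_(cell i), 0).
Definition cell_vec2 (i j : 'I_N) : @Xvec R :=
  (0, fun p => \1_(cell i) p.1 * \1_(cell j) p.2).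

Let indic_le1 (S : Type) (A : set S) (x : S) : `|\1_A x| <= 1 :> R.
Proof. by rewrite indicE; case: (_ \in _); rewrite ?normr1 ?normr0. Qed.

Lemma cell_vec1_inX i : inX (cell_vec1 i).
Proof.
split; last by case: (@inX0 R).
apply: (Lfun_oo_bounded mu1_gt0 (C := 1)).
  exact: measurable_indic (measurable_cell i).
by apply: aeW => x; exact: indic_le1.
Qed.

Lemma cell_vec2_inX i j : inX (cell_vec2 i j).
Proof.
split; first by case: (@inX0 R).
apply: (Lfun_oo_bounded mu2_gt0 (C := 1)).
  apply: measurable_funM.
    exact: (measurableT_comp (measurable_indic (measurable_cell i))).
  exact: (measurableT_comp (measurable_indic (measurable_cell j))).
by apply: aeW => x; rewrite normrM mulr_ile1//; exact: indic_le1.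
Qed.

(** Splits a step field into time-dependent coefficients and fixed vectors, which
    reduces differentiability of the field to that of its coefficients. *)
Lemma step_decomposition c d : (step1 c, step2 d) =
  \sum_i c i *: cell_vec1 i + \sum_i \sum_j d i j *: cell_vec2 i j :> @Xvec R.
Proof.
have fstS (I : Type) (r : seq I) (F : I -> @Xvec R) :
    (\sum_(i <- r) F i).1 = \sum_(i <- r) (F i).1.
  by elim/big_rec2 : _ => // i y1 y2 _ <-.
have sndS (I : Type) (r : seq I) (F : I -> @Xvec R) :
    (\sum_(i <- r) F i).2 = \sum_(i <- r) (F i).2.
  by elim/big_rec2 : _ => // i y1 y2 _ <-.
apply/pair_equal_spec; split; apply/funext => x.
- rewrite -[RHS]/((\sum_i c i *: cell_vec1 i).1 x +
    (\sum_i \sum_j d i j *: cell_vec2 i j).1 x).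
  rewrite !fstS [X in _ + X x](_ : _ = 0) ?addr0; last first.
    by rewrite big1// => i _; rewrite fstS big1// => j _; rewrite /= scaler0.
  by rewrite fct_sumE.
- rewrite -[RHS]/((\sum_i c i *: cell_vec1 i).2 x +
    (\sum_i \sum_j d i j *: cell_vec2 i j).2 x).
  rewrite !sndS [X in X x + _](_ : _ = 0) ?add0r; last first.
    by rewrite big1// => i _; rewrite /= scaler0.
  rewrite fct_sumE; apply: eq_bigr => i _.
  by rewrite sndS fct_sumE.
Qed.

Lemma stepX_weak_path T (th dth : 'I_N -> R -> R) (a da : 'I_N -> 'I_N -> R -> R) :
  (forall i, {within `[0, T], continuous (th i)}) ->
  (forall i j, {within `[0, T], continuous (a i j)}) ->
  (forall i t, 0 < t < T -> is_derive t 1 (th i) (dth i t)) ->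
  (forall i j t, 0 < t < T -> is_derive t 1 (a i j) (da i j t)) ->
  weak_path T (stepX th a) (stepX dth da).
Proof.
move=> cth ca hth ha.
have h1 := weak_path_sum (index_enum _)
  (fun i => weak_pathZ (cell_vec1_inX i) (cth i) (hth i)).
have h2 := weak_path_sum (index_enum _) (fun i => weak_path_sum (index_enum _)
  (fun j => weak_pathZ (cell_vec2_inX i j) (ca i j) (ha i j))).
by apply: (weak_path_ext _ _ (weak_pathD h1 h2)) => t; rewrite /stepX step_decomposition.
Qed.

Lemma inX_step c d : inX (step1 c, step2 d).
Proof.
rewrite step_decomposition; apply: inXD.
  elim/big_ind : _ => [|u v|i _]; [exact: inX0|exact: inXD|].
  exact/inXZ/cell_vec1_inX.
elim/big_ind : _ => [|u v|i _]; [exact: inX0|exact: inXD|].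
elim/big_ind : _ => [|u v|j _]; [exact: inX0|exact: inXD|].
exact/inXZ/cell_vec2_inX.
Qed.

Lemma ae_step2_le d C : (forall i j, `|d i j| <= C) -> \forall p \ae mu2, `|step2 d p| <= C.
Proof.
move=> dC.
move: (ae_mu2_fst ae_cell) (ae_mu2_snd ae_cell).
apply: (@filterS2 _ _ (ae_filter_ringOfSetsType mu2)) => -[x y] [i ix] [j jy].
by rewrite (step2_cell _ ix jy).
Qed.

(** A product of two cells has positive measure, so the essential supremum sees
    every coefficient. *)
Lemma step2_coef_le d i j : `|d i j| <= fine (norm2 (step2 d)).
Proof.
have [M [mM M0 hM]] := norm2_ae (@inX_step (fun=> 0) d).2.
apply: contrapT => h.
have sub : cell i `*` cell j `<=` M.
  by move=> [x y] [/= ix jy]; apply: hM => /=; rewrite (step2_cell _ ix jy).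
have [mi mj] := (measurable_cell i, measurable_cell j).
have c0 : mu2 (cell i `*` cell j) = 0%E.
  by apply: (@subset_measure0 _ _ _ mu2 _ M) => //; exact: measurableX.
move: c0; rewrite mu2X// !mu1_cell -EFinM => -[/eqP]; rewrite mulf_eq0 orbb invr_eq0.
by rewrite gt_eqF.
Qed.

End cells.

(** * The finite network *)

Section network.
Context {R : realType} (eps : R) (Gam : R -> R) (H : R * R -> R).
Hypotheses (eps0 : 0 < eps) (hG : is_Cb1 Gam) (hH : is_Cb1_2 H).
Local Notation mu1 := (@mu1 R).
Local Notation mu2 := (@mu2 R).
Local Notation rhs := (continuum_rhs eps Gam H).

Variables (N : nat) (om th0 : 'I_N -> R) (a0 : 'I_N -> 'I_N -> R)
  (th : 'I_N -> R -> R) (a : 'I_N -> 'I_N -> R -> R).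
Hypotheses (N0 : (0 < N)%N) (sol : network_solution eps Gam H om th0 a0 th a).

(** The step field solves the continuum equation because the interaction
    integral of a step field is the network sum: cells have mass 1/N. The
    two sides may differ outside the unit square. *)
Lemma rhs_step t : normX (stepX
    (fun i t => om i + N%:R^-1 * \sum_(j < N) a i j t * Gam (th j t - th i t))
    (fun i j t => eps^-1 * (- a i j t + H (th i t, th j t))) t -
  rhs (step1 om) (stepX th a t)) = 0%E.
Proof.
rewrite /normX; set w := _ - _.
suff [-> ->] : norm1 w.1 = 0%E /\ norm2 w.2 = 0%E by rewrite adde0.
split; apply/eqP; rewrite eq_le Lnorm_ge0 andbT.
- apply/(Lnorm_oo_leP mu1_gt0).
  move: (@ae_cell R N N0); apply: (@filterS _ _ (ae_filter_ringOfSetsType mu1)) => x [i ix].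
  pose b i j := a i j t * Gam (th j t - th i t).
  have -> : w.1 x = step1 (fun i => om i + N%:R^-1 * \sum_(j < N) b i j) x -
    (step1 om x + \int[mu1]_y (step2 (fun i j => a i j t) (x, y) *
      Gam (step1 (th ^~ t) y - step1 (th ^~ t) x))) by [].
  rewrite !(step1_cell N0 _ ix).
  have -> : \int[mu1]_y (step2 (fun i j => a i j t) (x, y) *
      Gam (step1 (th ^~ t) y - th i t)) = \int[mu1]_y step1 (b i) y.
    apply: eq_Rintegral => y _; rewrite (step2_row N0 _ _ ix).
    have [[j jy]|nojy] := pselect (exists j : 'I_N, cell j y).
      by rewrite !(step1_cell N0 _ jy).
    by rewrite !step1_out ?mul0r// => j jy; apply: nojy; exists j.
  by rewrite Rintegral_step1// subrr normr0.
- apply/(Lnorm_oo_leP mu2_gt0).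
  move: (ae_mu2_fst (@ae_cell R N N0)) (ae_mu2_snd (@ae_cell R N N0)).
  apply: (@filterS2 _ _ (ae_filter_ringOfSetsType mu2)) => -[x y] [i ix] [j jy].
  have -> : w.2 (x, y) = step2 (fun i j => eps^-1 * (- a i j t + H (th i t, th j t))) (x, y) -
    eps^-1 * (- step2 (fun i j => a i j t) (x, y) +
      H (step1 (th ^~ t) x, step1 (th ^~ t) y)) by [].
  by rewrite !(step2_cell N0 _ ix jy) (step1_cell N0 _ ix) (step1_cell N0 _ jy) subrr normr0.
Qed.

Lemma network_weak_path T : 0 < T ->
  weak_path T (stepX th a) (fun t => rhs (step1 om) (stepX th a t)).
Proof.
move=> T0; have [_ [cth ca] hth ha] := sol.
have IT : (`[0, T]%classic : set R) `<=` `[0, +oo[%classic by apply: subset_itvl; rewrite bnd_simp.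
have omL : step1 om \in Lfun mu1 +oo by case: (inX_step om (fun _ _ => 0)).
apply: (weak_path_congr (fun t _ => conj _ (rhs_step t))).
  by move=> t _; apply: (rhs_inX eps hG hH omL); exact: inX_step.
apply: stepX_weak_path => //.
- by move=> i; exact: continuous_subspaceW IT (cth i).
- by move=> i j; exact: continuous_subspaceW IT (ca i j).
- move=> i t /andP[t0 _]; have [d e] := hth i t t0.
  by apply: DeriveDef => //; rewrite -derive1E.
- move=> i j t /andP[t0 _]; have [d e] := ha i j t t0.
  by apply: DeriveDef => //; rewrite -derive1E -e mulKf// gt_eqF.
Qed.

(** The adaptation equation relaxes each weight towards a value of [H], so
    [exp (t / eps) (s a - Ra)] is nonincreasing for both signs [s]. *)
Lemma network_weight_le Ra t : 0 <= t -> supnorm H <= Ra ->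
  (forall i j, `|a0 i j| <= Ra) -> fine (norm2 (stepX th a t).2) <= Ra.
Proof.
move=> t0 HRa a0Ra; have [[_ a_0] [_ ca] _ ha] := sol.
have one (s : R) i j : `|s| = 1 -> s * a i j t <= Ra.
  move=> s1.
  pose f r := expR (eps^-1 * r) * (s * a i j r - Ra).
  pose df r := expR (eps^-1 * r) * (eps^-1 * (s * H (th i r, th j r) - Ra)).
  have hf r : 0 < r < t -> is_derive r 1 f (df r).
    move=> /andP[r0 _]; have [d e] := ha i j r r0.
    have ar : is_derive r 1 (a i j) (eps^-1 * (- a i j r + H (th i r, th j r))).
      by apply: DeriveDef => //; rewrite -derive1E -e mulKf// gt_eqF.
    have sa : is_derive r 1 (cst s * a i j - cst Ra)
        (s * (eps^-1 * (- a i j r + H (th i r, th j r)))).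
      have := is_deriveB (is_derive_cstM s ar) (is_derive_cst Ra r 1).
      by rewrite subr0; exact.
    have h := is_deriveM (is_derive_expRZ eps^-1 r) sa.
    apply: (@is_derive_eq _ _ _ _ _ _ _ _ h).
    by rewrite -[(cst s * a i j - cst Ra) r]/(s * a i j r - Ra) /df /GRing.scale/=; ring.
  have : f t <= f 0.
    apply: (le0_derive_le t0 hf).
      move=> r _; rewrite /df pmulr_rle0 ?expR_gt0// pmulr_rle0 ?invr_gt0//.
      rewrite subr_le0 (le_trans _ HRa)// (le_trans (ler_norm _))// normrM s1 mul1r.
      exact: H_le.
    have cf : {within `[0, t],
        continuous ((fun r => expR (eps^-1 * r)) \* ((cst s \* a i j) \- cst Ra))}.
      have IT : (`[0, t]%classic : set R) `<=` `[0, +oo[%classic by apply: subset_itvl; rewrite bnd_simp.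
      have ct := continuous_subspaceW IT (ca i j).
      move=> x; apply: cvgM.
        apply: continuous_subspaceT => y; have [+ _] := is_derive_expRZ eps^-1 y.
        by move=> /derivable1_diffP/differentiable_continuous.
      apply: cvgB; last exact: cvg_cst.
      by apply: cvgM; [exact: cvg_cst|exact: ct].
    exact: cf.
  rewrite /f mulr0 expR0 mul1r a_0 => h.
  rewrite -subr_le0 -(pmulr_rle0 _ (expR_gt0 (eps^-1 * t))) (le_trans h)//.
  by rewrite subr_le0 (le_trans (ler_norm _))// normrM s1 mul1r.
have Ut := inX_step (fun i => th i t) (fun i j => a i j t).
rewrite -lee_fin -(norm2_fineK Ut); apply/(Lnorm_oo_leP mu2_gt0).
apply: (ae_step2_le N0) => i j; rewrite ler_norml lerNl.
by have := one 1 i j; have := one (-1) i j; rewrite mul1r mulN1r normrN normr1 => -> // -> //.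
Qed.

End network.

(** * The convergence theorem *)

Section initial_data.
Context {R : realType}.
Local Notation n1 f := (fine (norm1 f)).
Local Notation n2 k := (fine (norm2 k)).
Implicit Types u v w : @Xvec R.

Lemma normX_sub_congr u v w : normX (v - w) = 0%E ->
  norm1 (u - v).1 = norm1 (u - w).1 /\ norm2 (u - v).2 = norm2 (u - w).2.
Proof.
have half (v' w' : @Xvec R) : normX (v' - w') = 0%E ->
    (norm1 (u - w')%R.1 <= norm1 (u - v')%R.1)%E /\
    (norm2 (u - w')%R.2 <= norm2 (u - v')%R.2)%E.
  move=> /normX_eq0[h1 h2].
  have -> : u - w' = (u - v') + (v' - w') by rewrite subrKA.
  have a1 : (norm1 (u - v' + (v' - w'))%R.1 <=
      norm1 (u - v')%R.1 + norm1 (v' - w')%R.1)%E := Lnorm_ooD mu1_gt0 _ _.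
  have a2 : (norm2 (u - v' + (v' - w'))%R.2 <=
      norm2 (u - v')%R.2 + norm2 (v' - w')%R.2)%E := Lnorm_ooD mu2_gt0 _ _.
  by rewrite h1 adde0 in a1; rewrite h2 adde0 in a2.
move=> vw; have wv : normX (w - v) = 0%E by rewrite normXC.
have [[a1 a2] [b1 b2]] := (half _ _ vw, half _ _ wv).
by split; apply/eqP; rewrite eq_le ?a1 ?a2 ?b1 ?b2.
Qed.

End initial_data.

Theorem theorem2p6 (R : realType) (eps : R) (Gam : R -> R) (H : R * R -> R)
    (om th0 : R -> R) (a0 : R * R -> R)
    (omN th0N : forall N, 'I_N -> R) (a0N : forall N, 'I_N -> 'I_N -> R)
    (thN : forall N, 'I_N -> R -> R) (aN : forall N, 'I_N -> 'I_N -> R -> R)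
    (u : R -> @Xvec R) :
  0 < eps ->
  is_Cb1 Gam -> periodic Gam (2 * pi) ->
  is_Cb1_2 H ->
  (forall y, periodic (fun x => H (x, y)) (2 * pi)) ->
  (forall x, periodic (fun y => H (x, y)) (2 * pi)) ->
  om \in Lfun mu1 +oo ->
  inX (th0, a0) ->
  (norm1 (step1 (th0N N) - th0)%R + norm2 (step2 (a0N N) - a0)%R
    + norm1 (step1 (omN N) - om)%R)%E @[N --> \oo] --> 0%E ->
  (forall N, (0 < N)%N ->
     network_solution eps Gam H (omN N) (th0N N) (a0N N) (thN N) (aN N)) ->
  (forall T, 0 < T -> strong_solution eps Gam H om (th0, a0) T u) ->
  let uN N t := stepX (thN N) (aN N) t in
  let Lam := Lambda_star Gam H (R_star H a0 a0N) in
  let MG := supnorm Gam in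
  let MD := M_DH H in
  let Eth N := fine (norm1 (step1 (th0N N) - th0)) in
  let Ea N := fine (norm2 (step2 (a0N N) - a0)) in
  let Eom N := fine (norm1 (step1 (omN N) - om)) in
  let supX T N :=
    ereal_sup [set normX (uN N t - u t) | t in `[0, T]%classic] in
  forall T, 0 < T ->
  [/\ supX T N @[N --> \oo] --> 0%E,
      (forall N, (0 < N)%N -> forall t, 0 <= t <= T ->
         (norm1 ((uN N t).1 - (u t).1)%R
            <= (expR (Lam * t) * (Eth N + t * Eom N + eps * MG * Ea N))%:E)%E
         /\
         (norm2 ((uN N t).2 - (u t).2)%R
            <= (expR (- t / eps) * Ea N
               + 2 * MD * expR (Lam * t)
                 * (Eth N + t * Eom N + eps * MG * Ea N))%:E)%E),
      (forall N, (0 < N)%N ->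
         (supX T N <= (Ea N + (1 + 2 * MD) * expR (Lam * T)
                       * (Eth N + T * Eom N + eps * MG * Ea N))%:E)%E)
    & (forall eps0, 0 < eps0 ->
         let C := 1 + (1 + 2 * MD) * expR (Lam * T)
                      * Num.max 1 (Num.max T (eps0 * MG)) in
         eps <= eps0 -> forall N, (0 < N)%N ->
           (supX T N <= (C * (Eth N + Ea N + Eom N))%:E)%E)].
Proof.
move=> eps0 hG _ hH _ _ omL u0X cv0 hN hu uN Lam MG MD Eth Ea Eom supX T T0.
have MD0 : 0 <= MD := M_DH_ge0 hH.
have MG0 : 0 <= MG := MG_ge0 hG.
have Eth0 N : 0 <= Eth N := fine_norm1_ge0 _.
have Ea0 N : 0 <= Ea N := fine_norm2_ge0 _.
have Eom0 N : 0 <= Eom N := fine_norm1_ge0 _.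
have S0X N : inX (step1 (th0N N), step2 (a0N N)) := inX_step _ _.
have dX N : inX ((step1 (th0N N), step2 (a0N N)) - (th0, a0)) := inXB (S0X N) u0X.
have omNL N : step1 (omN N) \in Lfun mu1 +oo.
  by case: (inX_step (omN N) (fun _ _ => 0)).
have domL N : step1 (omN N) - om \in Lfun mu1 +oo.
  by apply: (Lfun_ooD mu1_gt0) => //; exact: Lfun_ooN.
have cvE : (fun N => Eth N + Ea N + Eom N) @ \oo --> (0 : R).
  have : (fun N => (Eth N + Ea N + Eom N)%:E) @ \oo --> 0%E.
    rewrite [X in X @ _ --> _](_ : _ = (fun N => norm1 (step1 (th0N N) - th0)%R +
      norm2 (step2 (a0N N) - a0)%R + norm1 (step1 (omN N) - om)%R)%E)//.
    apply/funext => N.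
    rewrite !EFinD.
    rewrite -(norm1_fineK (dX N)) -(norm2_fineK (dX N)) /Eom fineK//.
    by case: ((Lfun_ooP _ _).1 (domL N)) => _ ?; rewrite ge0_fin_numE ?Lnorm_ge0.
  by move=> /fine_cvgP[].
(* The supremum in [R_star] is one of a bounded set because the initial data
   converge; otherwise it would have the default value 0. *)
have ubR : has_ubound [set fine (norm2 (step2 (a0N N))) | N in [set N | (0 < N)%N]].
  have /cvg_seq_bounded/pinfty_ex_gt0[M M0 hM] : cvgn (fun N => Eth N + Ea N + Eom N).
    by apply/cvg_ex; exists 0.
  exists (M + fine (norm2 a0)) => _ [N _ <-].
  have /= EM := hM N Logic.I.
  rewrite -lee_fin EFinD -(norm2_fineK (S0X N)) -(norm2_fineK u0X).
  have := Lnorm_ooD mu2_gt0 (step2 (a0N N) - a0) a0; rewrite subrK.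
  move=> h; apply: (le_trans h); rewrite leeD2r//.
  rewrite -/(norm2 _) -[X in norm2 X]/(((step1 (th0N N), step2 (a0N N)) - (th0, a0)).2).
  rewrite (norm2_fineK (dX N)) lee_fin (le_trans _ (le_trans (ler_norm _) EM))//.
  by rewrite -[leLHS]/(Ea N) -addrA addrCA lerDl addr_ge0.
pose Ra := R_star H a0 a0N.
have HRa : supnorm H <= Ra by rewrite /Ra /R_star le_max lexx.
have Ra0 : 0 <= Ra.
  by apply: le_trans HRa; case: hH => _ _ [b _ _]; exact: (supnorm_ge0 (0, 0) b).
have Lam0 : 0 <= Lam.
  by rewrite /Lam /Lambda_star addr_ge0// !mulr_ge0//; exact: LG_ge0 hG.
have a0Ra N : (0 < N)%N -> forall i j, `|a0N N i j| <= Ra.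
  move=> N0 i j; apply: (le_trans (step2_coef_le N0 _ _ _)).
  rewrite /Ra /R_star !le_max; apply/orP; right; apply/orP; right.
  by apply: ub_le_sup => //; exists N.
have cu := strong_solution_is_derive eps0 hG hH T0 omL (hu _ T0).
have upath : weak_path T u (fun t => continuum_rhs eps Gam H om (u t)).
  have [cu1 _ _] := cu _ (contraction_mean1 (@measurable0 _ _)).
  split=> // t t0T; split; last by move=> L HL; have [_ _ ] := cu L HL; apply.
  apply: (rhs_inX eps hG hH omL).
  have [|//] := cu1 t; rewrite /= in_itv/= ; case/andP: t0T => t0 tT.
  by rewrite !ltW.
have [u_0 _] := hu _ T0.
have stab N : (0 < N)%N -> forall t, 0 <= t <= T ->
    fine (norm1 (uN N t - u t).1) <=
      expR (Lam * t) * (Eth N + t * Eom N + eps * MG * Ea N) /\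
    fine (norm2 (uN N t - u t).2) <= expR (- t / eps) * Ea N +
      2 * MD * (expR (Lam * t) * (Eth N + t * Eom N + eps * MG * Ea N)).
  move=> N0 t tT.
  have init : uN N 0 = (step1 (th0N N), step2 (a0N N)).
    have [[i1 i2] _ _ _] := hN _ N0; rewrite /uN /stepX.
    have -> : (fun i => thN N i 0) = th0N N by apply/funext.
    by have -> : (fun i j => aN N i j 0) = a0N N by apply/funext => i; apply/funext.
  have [e1 e2] := normX_sub_congr (uN N 0) u_0.
  have := stability eps0 hG hH T0 (omNL N) omL
    (network_weak_path eps0 hG hH N0 (hN _ N0) T0) upath _ tT.
  move=> /(_ Ra) /=.
  rewrite -/(uN N 0) e1 e2 init; apply.
  by move=> s /andP[s0 _]; apply: (network_weight_le eps0 hH N0 (hN _ N0)) => //; exact: a0Ra.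
have tX N t : (0 < N)%N -> 0 <= t <= T -> inX (uN N t - u t).
  move=> N0 tT; apply: inXB; first exact: inX_step.
  by apply: (upath.1 t _).1; rewrite /= in_itv.
have sup_le N : (0 < N)%N -> (supX T N <= (Ea N + (1 + 2 * MD) * expR (Lam * T)
                       * (Eth N + T * Eom N + eps * MG * Ea N))%:E)%E.
  move=> N0; apply: ge_ereal_sup => _ [t tI <-].
  have tT : 0 <= t <= T by move: tI; rewrite /= in_itv.
  have /andP[t0 tleT] := tT.
  rewrite (normX_fin (tX _ _ N0 tT)) lee_fin; have [h1 h2] := stab _ N0 _ tT.
  apply: (le_trans (lerD h1 h2)).
  set B := _ * (_ + _ + _).
  rewrite addrCA -[X in _ + (X + _)]mul1r -mulrDl -mulrA; apply: lerD.
    by rewrite ler_piMl// -expR0 ler_expR mulNr oppr_le0 divr_ge0// ltW.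
  rewrite ler_wpM2l ?addr_ge0 ?mulr_ge0// /B ler_pM ?expR_ge0//.
  - by rewrite !addr_ge0// !mulr_ge0// ltW.
  - by rewrite ler_expR ler_wpM2l.
  - by rewrite lerD2r lerD2l ler_wpM2r.
have sup_le' eps1 : 0 < eps1 ->
         let C := 1 + (1 + 2 * MD) * expR (Lam * T)
                      * Num.max 1 (Num.max T (eps1 * MG)) in
         eps <= eps1 -> forall N, (0 < N)%N ->
           (supX T N <= (C * (Eth N + Ea N + Eom N))%:E)%E.
  move=> eps10 C ee N N0; apply: (le_trans (sup_le _ N0)); rewrite lee_fin /C.
  set mx := Num.max _ _.
  have [m1 mT me] : [/\ 1 <= mx, T <= mx & eps1 * MG <= mx].
    by rewrite /mx !le_max !lexx !orbT.
  rewrite [leRHS]mulrDl mul1r; apply: lerD.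
    by rewrite -addrA addrCA lerDl addr_ge0.
  rewrite -[leRHS]mulrA ler_wpM2l ?mulr_ge0 ?addr_ge0 ?mulr_ge0 ?expR_ge0//.
  rewrite [X in mx * X]addrAC !mulrDr; apply: lerD; first apply: lerD.
  - by rewrite ler_peMl.
  - by rewrite ler_wpM2r.
  - by rewrite ler_wpM2r// (le_trans _ me)// ler_wpM2r.
split=> //.
- pose C := 1 + (1 + 2 * MD) * expR (Lam * T) * Num.max 1 (Num.max T (eps * MG)).
  apply: (@squeeze_cvge _ _ _ _ (fun=> 0%E) _ (fun N => (C * (Eth N + Ea N + Eom N))%:E)).
  + exists 1%N => // N /= N0; rewrite sup_le'// andbT.
    apply: ereal_sup_ge; exists (normX (uN N 0 - u 0)); last exact: normX_ge0.
    by exists 0 => //=; rewrite in_itv/= lexx ltW.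
  + exact: cvg_cst.
  + apply: cvg_EFin; first exact: nearW.
    have h : (fun N => C * (Eth N + Ea N + Eom N)) @ \oo --> C * 0.
      by apply: cvgM; [exact: cvg_cst|exact: cvE].
    by rewrite mulr0 in h.
- move=> N N0 t tT; have [h1 h2] := stab _ N0 _ tT.
  rewrite -[X in norm1 X]/((uN N t - u t).1) -[X in norm2 X]/((uN N t - u t).2).
  rewrite (norm1_fineK (tX _ _ N0 tT)) (norm2_fineK (tX _ _ N0 tT)) !lee_fin.
  by split=> //; rewrite -mulrA.
Qed.
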